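(* For every nondeterministic protocol $\Pi=(\mathcal R,t)$ on domain $D=\{0,1\}^{n_1}\times\{0,1\}^{n_2}$ and every input pair $(x,y)\in D$, writing $t_{x,y}=t(x,y)$: (1) $\mathrm{IC}_\Pi(x,y) = C(t_{x,y}\mid\Pi)-I(x:y:t_{x,y}\mid\Pi)\pm O(\log n)$; (2) $\mathrm{IC}_\Pi(x,y)\le C(t_{x,y}\mid\Pi)+\log\rho(t_{x,y})+O(\log n)$, where $n$ is the maximum length of the strings involved.
   Context: Fix a universal Turing machine $U$. $C(x\mid u)$ is the length of a shortest $p$ with $U(p,u)=x$; tuples and finite objects are encoded as strings by fixed computable encodings. $I(x:y\mid u)=C(x\mid u)+C(y\mid u)-C(x,y\mid u)$, and $I(u:v:w\mid z)=C(u\mid z)+C(v\mid z)+C(w\mid z)-C(u,v\mid z)-C(u,w\mid z)-C(v,w\mid z)+C(u,v,w\mid z)$. A rectangle in $D$ is a set of the form $S\times T$. A (nondeterministic) protocol $\Pi=(\mathcal R,t)$ consists of a finite set $\mathcal R$ of rectangles whose union contains $D$, and a function $t$ assigning to each $(x,y)\in D$ a rectangle $t(x,y)\in\mathcal R$ containing $(x,y)$. $\Pi$ is regarded as a finite object, and the rectangle $t(x,y)$ is identified with a string encoding its index in $\mathcal R$. The thickness $\rho_{x,y}$ of a cell is the number of rectangles of $\mathcal R$ containing it; the thickness of a rectangle $R$ is $\rho(R)=\max_{(x,y)\in R}\rho_{x,y}$. The internal information cost of $\Pi$ on $(x,y)$ is $\mathrm{IC}_\Pi(x,y)=I(x:t_{x,y}\mid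 y,\Pi)+I(y:t_{x,y}\mid x,\Pi)$. *)

(* Defs.v *)
From HB Require Import structures.
From mathcomp Require Import all_boot all_order all_algebra.
From mathcomp Require Import boolp reals exp.

Set Implicit Arguments.
Unset Strict Implicit.
Unset Printing Implicit Defensive.

Import Order.TTheory GRing.Theory Num.Theory.

Local Open Scope ring_scope.

Definition str := seq bool.

(* Deterministic multitape Turing machines over the tape alphabet
   {0, 1, blank}; [None] is the blank. *)

Definition symbol : Type := option bool.

Inductive move := MoveLeft | Stay | MoveRight.

(* A two-way infinite tape. [tleft] and [tright] list the cells on the two sides
   of the head, nearest first; the cells beyond these lists are blank. *)
Record tape := Tape { tleft : seq symbol; tcur : symbol; tright : seq symbol }.

Definition tape_write (a : symbol) (t : tape) : tape :=
  Tape (tleft t) a (tright t).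

Definition tape_move (m : move) (t : tape) : tape :=
  match m with
  | MoveLeft =>
      Tape (behead (tleft t)) (head None (tleft t)) (tcur t :: tright t)
  | Stay => t
  | MoveRight =>
      Tape (tcur t :: tleft t) (head None (tright t)) (behead (tright t))
  end.

Definition tape_of_str (s : str) : tape :=
  Tape [::] (ohead s) (map Some (behead s)).

Fixpoint bits_until_blank (s : seq symbol) : str :=
  if s is Some b :: s' then b :: bits_until_blank s' else [::].

Definition str_of_tape (t : tape) : str :=
  bits_until_blank (tcur t :: tright t).

(* The machine has [tm_work + 2] tapes. *)
Record TM := MkTM {
  tm_work : nat;
  tm_state : finType;
  tm_start : tm_state;
  tm_halt : pred tm_state;
  tm_trans : tm_state -> {ffun 'I_tm_work.+2 -> symbol} ->
             tm_state * {ffun 'I_tm_work.+2 -> symbol * move}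
}.

Definition tapes (M : TM) : Type := {ffun 'I_(tm_work M).+2 -> tape}.

Definition config (M : TM) : Type := (tm_state M * tapes M)%type.

(* The input p is on tape 0, the condition u on tape 1. *)
Definition tm_init (M : TM) (p u : str) : config M :=
  (tm_start M,
   [ffun i : 'I_(tm_work M).+2 =>
      tape_of_str (if i == 0%N :> nat then p
                   else if i == 1%N :> nat then u else [::])]).

Definition tm_step (M : TM) (c : config M) : config M :=
  if tm_halt c.1 then c else
  let: (q, a) := tm_trans c.1 [ffun i => tcur (c.2 i)] in
  (q, [ffun i => tape_move (a i).2 (tape_write (a i).1 (c.2 i))]).

(* [computes M p u x] is M(p, u) = x: M halts on (p, u), and x is read on tape 0
   from the head rightwards up to the first blank. *)
Definition computes (M : TM) (p u x : str) : Prop :=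
  exists k : nat, let c := iter k (@tm_step M) (tm_init M p u) in
    tm_halt c.1 /\ str_of_tape (c.2 ord0) = x.

(* U simulates every machine M: each program of M translates into a program of U
   with the same behaviour on every condition, the increase in length being
   bounded by a constant that depends on M only. *)
Definition universal (U : TM) : Prop :=
  forall M : TM, exists c : nat, forall p : str, exists2 q : str,
    (size q <= size p + c)%N &
    forall u x : str, computes U q u x <-> computes M p u x.

(* The value 0 taken when no program describes x given u is never used for a
   universal U, by [universal_describes]. *)
Definition KC (U : TM) (x u : str) : nat :=
  match pselect (exists l, `[< exists2 p, size p = l & computes U p u x >]) with
  | left h => ex_minn h
  | right _ => 0%N
  end.

Lemma universal_describes (U : TM) (x u : str) :
  universal U -> exists p, computes U p u x.
Proof.
pose M := @MkTM 0 unit tt predT (fun q _ => (q, [ffun=> (None, Stay)])).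
move=> /(_ M)[c /(_ x)[q _ Uq]]; exists q; apply/Uq; exists 0%N; split=> //=.
rewrite ffunE /=; case: x {Uq} => //= b s; rewrite /str_of_tape /=; congr (_ :: _).
by elim: s => //= ? ? ->.
Qed.

Lemma KCP (U : TM) (x u : str) : universal U ->
  (exists2 p, size p = KC U x u & computes U p u x) /\
  (forall p, computes U p u x -> (KC U x u <= size p)%N).
Proof.
move=> hU; rewrite /KC; case: pselect => [h|[]]; last first.
  by have [p hp] := universal_describes x u hU; exists (size p); apply/asboolP; exists p.
case: ex_minnP => m /asboolP hm min; split=> // p hp.
by apply: min; apply/asboolP; exists p.
Qed.

(* Self-delimiting code b1 ... bk |-> 1 b1 ... 1 bk 0. *)
Fixpoint self_delim (s : str) : str :=
  if s is b :: s' then [:: true, b & self_delim s'] else [:: false].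

Definition enc_list (l : seq str) : str := flatten (map self_delim l).

(* [enc_nat] is the bijection between nat and strings that enumerates strings by
   length (bijective base-2 numeration, least significant digit first). *)
Fixpoint str_succ (s : str) : str :=
  match s with
  | [::] => [:: false]
  | false :: s' => true :: s'
  | true :: s' => false :: str_succ s'
  end.

Definition enc_nat (k : nat) : str := iter k str_succ [::].

Definition KC2 (U : TM) (x y u : str) : nat := KC U (enc_list [:: x; y]) u.

Definition KC3 (U : TM) (x y z u : str) : nat := KC U (enc_list [:: x; y; z]) u.

Definition I2 (U : TM) (x y u : str) : int :=
  (KC U x u)%:Z + (KC U y u)%:Z - (KC2 U x y u)%:Z.

Definition I3 (U : TM) (u v w z : str) : int :=
  (KC U u z)%:Z + (KC U v z)%:Z + (KC U w z)%:Z
  - (KC2 U u v z)%:Z - (KC2 U u w z)%:Z - (KC2 U v w z)%:Z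
  + (KC3 U u v w z)%:Z.

Definition cube (n : nat) := n.-tuple bool.

Definition is_rectangle (n1 n2 : nat) (A : {set cube n1 * cube n2}) : Prop :=
  exists (S : {set cube n1}) (T : {set cube n2}), A = setX S T.

(* The finite set of rectangles is a duplicate-free sequence, so that "the index
   of a rectangle" has a meaning; every ordering of the set is allowed. *)
Record protocol (n1 n2 : nat) := Protocol {
  rects : seq {set cube n1 * cube n2};
  chosen : {ffun cube n1 * cube n2 -> {set cube n1 * cube n2}};
  rects_uniq : uniq rects;
  rects_rectangle : forall A, A \in rects -> is_rectangle A;
  rects_cover : forall xy, exists2 A, A \in rects & xy \in A;
  chosen_rects : forall xy, chosen xy \in rects;
  chosen_mem : forall xy, xy \in chosen xy
}.

Definition transcript (n1 n2 : nat) (Pi : protocol n1 n2)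
    (x : cube n1) (y : cube n2) : str :=
  enc_nat (index (chosen Pi (x, y)) (rects Pi)).

(* {0,1}^n in lexicographic order *)
Fixpoint words (n : nat) : seq (cube n) :=
  if n is m.+1 then
    [seq cons_tuple b w | b <- [:: false; true], w <- words m]
  else [:: [tuple]].

Definition enc_set (n1 n2 : nat) (A : {set cube n1 * cube n2}) : str :=
  [seq (x, y) \in A | x <- words n1, y <- words n2].

(* n1, n2, the truth tables of the rectangles, and the table of t *)
Definition enc_protocol (n1 n2 : nat) (Pi : protocol n1 n2) : str :=
  enc_list
    [:: enc_nat n1; enc_nat n2;
        enc_list [seq enc_set A | A <- rects Pi];
        enc_list [seq transcript Pi x y | x <- words n1, y <- words n2]].

Definition cell_thickness (n1 n2 : nat) (Pi : protocol n1 n2)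
    (xy : cube n1 * cube n2) : nat :=
  count (fun A : {set cube n1 * cube n2} => xy \in A) (rects Pi).

Definition thickness (n1 n2 : nat) (Pi : protocol n1 n2)
    (A : {set cube n1 * cube n2}) : nat :=
  (\max_(xy in A) cell_thickness Pi xy)%N.

Definition IC (U : TM) (n1 n2 : nat) (Pi : protocol n1 n2)
    (x : cube n1) (y : cube n2) : int :=
  let t := transcript Pi x y in
  I2 U x t (enc_list [:: y : str; enc_protocol Pi])
  + I2 U y t (enc_list [:: x : str; enc_protocol Pi]).

Definition max_length (n1 n2 : nat) (Pi : protocol n1 n2)
    (x : cube n1) (y : cube n2) : nat :=
  maxn (maxn (size x) (size y)) (size (transcript Pi x y)).

Definition log2 (R : realType) (a : R) : R := ln a / ln 2.

(* Main.v *)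
Require Import Defs.
From HB Require Import structures.
From mathcomp Require Import all_boot all_order all_algebra.
From mathcomp Require Import boolp reals exp.
From mathcomp Require Import zify lra.

Set Implicit Arguments.
Unset Strict Implicit.
Unset Printing Implicit Defensive.

Import Order.TTheory GRing.Theory Num.Theory.


(* Write K for complexity given Pi. Symmetry of information turns IC into
   2K(x,y) + K(x,t) + K(y,t) - K(x) - K(y) - 2K(x,y,t), and K(x,y,t) = K(x,y)
   because t is read off the table of Pi; this is (1). For (2) it remains to
   bound K(t) + K(x|t) + K(y|t) by K(x) + K(y) + log rho. Let the rectangle t
   contain about 2^al rows x' with K(x') <= K(x) and 2^be columns y' with
   K(y') <= K(y). Then K(x|t) <= al and K(y|t) <= be, while there are at most
   rho 2^(K(x)+K(y)-al-be) such rectangles of thickness at most rho: each holds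
   2^(al+be) of the 2^(K(x)+K(y)) pairs (x', y'), and no pair lies in more than
   rho of them. Enumerating these rectangles bounds K(t).

   Every upper bound on complexity comes from one principle: the n-th element of
   a computably enumerated set of size 2^k has complexity k plus the cost of the
   parameters. The enumerations dovetail the runs of U. They are written as
   functions on binary trees, compiled to programs on bit stacks, and these to
   Turing machines whose tapes are the stacks. *)

(** * Stack programs and their compilation to Turing machines *)

(** The error has to be logarithmic in the lengths of [x], [y] and [t], while the code of the
    protocol can be exponentially longer. Hence the protocol occurs only inside conditions, never in
    a described string, and each enumeration is steered by its condition and by a few numbers of
    size O(n), worth O(log n) bits each. Complexity can only be approximated from above, so at no
    stage are the counts of simple rows and columns known to be final. The parameter passed for such
    a count is the exponent of the largest power of two that it ever reaches: some finite stage
    witnesses this power, and no stage exceeds its double. A family defined by lower bounds on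
    growing counts grows with the stage, as an enumeration needs. Universality speaks of machines,
    so each search must be exhibited as an actual machine; hence the compiler. *)

Inductive reg := RP | RU | RM | RA | RB | RC | RF.

(** [sP] and [sU] are the two input tapes, [sP] also the output; [sM] holds the data, [sA] and [sB]
    are scratch space, [sC] counts subtrees during a traversal and [sF] is the flag of a while
    loop. *)
Record stacks := Stacks {
  sP : seq bool; sU : seq bool; sM : seq bool; sA : seq bool;
  sB : seq bool; sC : seq bool; sF : seq bool }.

Definition get (s : stacks) (r : reg) : seq bool :=
  match r with
  | RP => sP s | RU => sU s | RM => sM s | RA => sA s
  | RB => sB s | RC => sC s | RF => sF s
  end.

Definition put (s : stacks) (r : reg) (v : seq bool) : stacks :=
  let: Stacks p u m a b c f := s in
  match r with
  | RP => Stacks v u m a b c f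
  | RU => Stacks p v m a b c f
  | RM => Stacks p u v a b c f
  | RA => Stacks p u m v b c f
  | RB => Stacks p u m a v c f
  | RC => Stacks p u m a b v f
  | RF => Stacks p u m a b c v
  end.

Inductive stmt :=
  | Skip
  | Push of reg & bool
  | PopCase of reg & stmt & stmt & stmt
  | Seq of stmt & stmt
  | Loop of reg & stmt & stmt.

Inductive exec : stmt -> stacks -> stacks -> Prop :=
  | exec_skip s : exec Skip s s
  | exec_push r b s : exec (Push r b) s (put s r (b :: get s r))
  | exec_pop r s0 s1 sN s s' b l : get s r = b :: l ->
      exec (if b then s1 else s0) (put s r l) s' ->
      exec (PopCase r s0 s1 sN) s s'
  | exec_popN r s0 s1 sN s s' : get s r = [::] -> exec sN s s' ->
      exec (PopCase r s0 s1 sN) s s'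
  | exec_seq p q s s1 s2 : exec p s s1 -> exec q s1 s2 -> exec (Seq p q) s s2
  | exec_loopN r s0 s1 s : get s r = [::] -> exec (Loop r s0 s1) s s
  | exec_loop r s0 s1 s s' s'' b l : get s r = b :: l ->
      exec (if b then s1 else s0) (put s r l) s' ->
      exec (Loop r s0 s1) s' s'' -> exec (Loop r s0 s1) s s''.

Definition ord_of_reg (r : reg) : 'I_7 :=
  match r with
  | RP => @Ordinal 7 0 isT | RU => @Ordinal 7 1 isT | RM => @Ordinal 7 2 isT
  | RA => @Ordinal 7 3 isT | RB => @Ordinal 7 4 isT | RC => @Ordinal 7 5 isT
  | RF => @Ordinal 7 6 isT
  end.

Lemma get_put (s : stacks) (r r' : reg) (v : seq bool) :
  get (put s r v) r' = if ord_of_reg r' == ord_of_reg r then v else get s r'.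
Proof. by case: s => *; case: r; case: r'. Qed.

(** * Machine fragments and their composition *)

Definition reads := {ffun 'I_7 -> symbol}.
Definition actions := {ffun 'I_7 -> symbol * move}.
Definition alltapes := {ffun 'I_7 -> tape}.

(* A machine fragment; the transition to [None] leaves the fragment. *)
Record frag := Frag {
  fstate : finType;
  fstart : fstate;
  ftrans : fstate -> reads -> option fstate * actions }.

Definition apply_actions (a : actions) (T : alltapes) : alltapes :=
  [ffun i => tape_move (a i).2 (tape_write (a i).1 (T i))].

Definition tapes_reads (T : alltapes) : reads := [ffun i => tcur (T i)].

Definition frag_step (f : frag) (c : option (fstate f) * alltapes) :=
  if c.1 is Some q then
    let o := ftrans q (tapes_reads c.2) in (o.1, apply_actions o.2 c.2)
  else c.

Definition reaches (f : frag) (c c' : option (fstate f) * alltapes) :=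
  exists k, iter k (@frag_step f) c = c'.

Lemma reaches_step f c c' : @reaches f (frag_step c) c' -> reaches c c'.
Proof. by case=> k <-; exists k.+1; rewrite iterSr. Qed.

Lemma reaches_refl f c : @reaches f c c.
Proof. by exists 0. Qed.

Lemma reaches_trans f c1 c2 c3 :
  @reaches f c1 c2 -> reaches c2 c3 -> reaches c1 c3.
Proof. by move=> [k <-] [l <-]; exists (l + k); rewrite iterD. Qed.

(** Serves every composite fragment: [e] places the states of a component and [x] is where its exit
    is redirected, so a run up to the exit is copied step by step. *)
Lemma reaches_embed (f g : frag) (e : fstate f -> fstate g)
    (x : option (fstate g)) :
  (forall q r, ftrans (e q) r =
     (if (ftrans q r).1 is Some q' then Some (e q') else x, (ftrans q r).2)) ->
  forall q T T', reaches (Some q, T) (None, T') ->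
  reaches (Some (e q), T) (x, T').
Proof.
move=> he q T T' [k]; elim: k q T => [|k IH] q T; first by [].
rewrite iterSr /frag_step /= -/(@frag_step f).
case E: (ftrans q _) => [[q'|] a] /= H.
  by apply: reaches_step; rewrite /frag_step /= he E /=; exact: IH.
(* After the exit the configuration of the fragment no longer changes. *)
have -> : T' = apply_actions a T.
  by move: H; rewrite iter_fix // => -[].
by apply: reaches_step; rewrite /frag_step /= he E; exact: reaches_refl.
Qed.

Definition keep (r : reads) : actions := [ffun i => (r i, Stay)].

Definition act_on (r : reads) (x : reg) (a : symbol * move) : actions :=
  [ffun i => if i == ord_of_reg x then a else (r i, Stay)].

Definition frag_skip : frag :=
  @Frag unit tt (fun _ r => (None, keep r)).

(** A machine step writes before it moves, so a push takes two steps: one moves left and leaves the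
    old top in place, the other writes the new one. *)
Definition frag_push (x : reg) (b : bool) : frag :=
  @Frag bool false (fun q r =>
    if q then (None, act_on r x (Some b, Stay))
    else (Some true, act_on r x (r (ord_of_reg x), MoveLeft))).

Definition pop_act (r : reads) (x : reg) : actions :=
  if r (ord_of_reg x) is Some b then act_on r x (Some b, MoveRight) else keep r.

Definition frag_pop (x : reg) (f0 f1 fN : frag) : frag :=
  @Frag (option (fstate f0 + fstate f1 + fstate fN)) None (fun q r =>
    match q with
    | None =>
      (Some (Some (match r (ord_of_reg x) with
         | Some false => inl (inl (fstart f0))
         | Some true => inl (inr (fstart f1))
         | None => inr (fstart fN)
         end)), pop_act r x)
    | Some (inl (inl q)) => let: o := ftrans q r in
        (if o.1 is Some q' then Some (Some (inl (inl q'))) else None, o.2)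
    | Some (inl (inr q)) => let: o := ftrans q r in
        (if o.1 is Some q' then Some (Some (inl (inr q'))) else None, o.2)
    | Some (inr q) => let: o := ftrans q r in
        (if o.1 is Some q' then Some (Some (inr q')) else None, o.2)
    end).

Definition frag_seq (f g : frag) : frag :=
  @Frag (fstate f + fstate g)%type (inl (fstart f)) (fun q r =>
    match q with
    | inl q => let: o := ftrans q r in
        (Some (if o.1 is Some q' then inl q' else inr (fstart g)), o.2)
    | inr q => let: o := ftrans q r in
        (if o.1 is Some q' then Some (inr q') else None, o.2)
    end).

Definition frag_loop (x : reg) (f0 f1 : frag) : frag :=
  @Frag (option (fstate f0 + fstate f1)) None (fun q r =>
    match q with
    | None =>
      (match r (ord_of_reg x) with
       | Some false => Some (Some (inl (fstart f0)))
       | Some true => Some (Some (inr (fstart f1)))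
       | None => None
       end, pop_act r x)
    | Some (inl q) => let: o := ftrans q r in
        (Some (if o.1 is Some q' then Some (inl q') else None), o.2)
    | Some (inr q) => let: o := ftrans q r in
        (Some (if o.1 is Some q' then Some (inr q') else None), o.2)
    end).

Fixpoint frag_of (p : stmt) : frag :=
  match p with
  | Skip => frag_skip
  | Push x b => frag_push x b
  | PopCase x p0 p1 pN => frag_pop x (frag_of p0) (frag_of p1) (frag_of pN)
  | Seq p q => frag_seq (frag_of p) (frag_of q)
  | Loop x p0 p1 => frag_loop x (frag_of p0) (frag_of p1)
  end.

(* Popping only moves the head right, so what lies left of the head is garbage
   that a later push overwrites. *)
Definition represents (T : alltapes) (s : stacks) :=
  forall r, str_of_tape (T (ord_of_reg r)) = get s r.

Lemma apply_keep T : apply_actions (keep (tapes_reads T)) T = T.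
Proof. by apply/ffunP => i; rewrite !ffunE /=; case: (T i). Qed.

Lemma represents_pop T s x b l : represents T s -> get s x = b :: l ->
  tapes_reads T (ord_of_reg x) = Some b /\
  represents (apply_actions (pop_act (tapes_reads T) x) T) (put s x l).
Proof.
move=> hT hx; have E : tapes_reads T (ord_of_reg x) = Some b.
  rewrite ffunE; move: (hT x); rewrite hx /str_of_tape.
  by case: (T _) => L [c|] Rt //= [->].
split=> // r; rewrite get_put /pop_act E !ffunE.
case: eqP => [->|_]; last by rewrite -hT; case: (T _).
move: (hT x); rewrite hx /str_of_tape; case: (T _) => L [c|] [|d Rt] //= [_] //.
Qed.

Lemma represents_pop0 T s x : represents T s -> get s x = [::] ->
  tapes_reads T (ord_of_reg x) = None /\
  apply_actions (pop_act (tapes_reads T) x) T = T.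
Proof.
move=> hT hx; have E : tapes_reads T (ord_of_reg x) = None.
  rewrite ffunE; move: (hT x); rewrite hx /str_of_tape.
  by case: (T _) => L [c|] Rt.
by split; rewrite // /pop_act E apply_keep.
Qed.

Lemma exec_reaches p s s' : exec p s s' -> forall T, represents T s ->
  exists2 T', represents T' s' &
    @reaches (frag_of p) (Some (fstart (frag_of p)), T) (None, T').
Proof.
elim=> {p s s'} [s|x b s|x p0 p1 pN s s' b l hx _ IH|x p0 p1 pN s s' hx _ IH
                |p q s s1 s2 _ IHp _ IHq|x p0 p1 s hx|x p0 p1 s s' s'' b l hx _ IH1 _ IH2] T hT.
- exists T => //; apply: reaches_step; rewrite /frag_step /= apply_keep.
  exact: reaches_refl.
- pose a1 := act_on (tapes_reads T) x (tapes_reads T (ord_of_reg x), MoveLeft).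
  pose T1 := apply_actions a1 T.
  exists (apply_actions (act_on (tapes_reads T1) x (Some b, Stay)) T1).
    move=> r; rewrite get_put !ffunE; case: eqP => [->|_].
      by rewrite -hT /str_of_tape; case: (T _).
    by rewrite -hT; case: (T _).
  do 2!apply: reaches_step.
  exact: reaches_refl.
- have [E hT1] := represents_pop hT hx.
  have [T' hT' H] := IH _ hT1; exists T' => //.
  apply: reaches_step; rewrite /frag_step /= E; case: b H {E IH hx} => H.
    exact: (reaches_embed (g := frag_of (PopCase x p0 p1 pN))
              (e := fun q => Some (inl (inr q))) (x := None) _ H).
  exact: (reaches_embed (g := frag_of (PopCase x p0 p1 pN))
              (e := fun q => Some (inl (inl q))) (x := None) _ H).
- have [E hT1] := represents_pop0 hT hx.
  have [T' hT' H] := IH _ hT; exists T' => //.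
  apply: reaches_step; rewrite /frag_step /= E hT1.
  exact: (reaches_embed (g := frag_of (PopCase x p0 p1 pN))
              (e := fun q => Some (inr q)) (x := None) _ H).
- have [T1 hT1 H1] := IHp _ hT; have [T2 hT2 H2] := IHq _ hT1; exists T2 => //.
  apply: (@reaches_trans (frag_of (Seq p q)) _ (Some (inr (fstart (frag_of q))), T1)).
    apply: (reaches_embed (g := frag_of (Seq p q)) (e := inl) _ H1) => q' r /=.
    by case: (ftrans q' r) => [[]].
  exact: (reaches_embed (g := frag_of (Seq p q)) (e := inr) (x := None) _ H2).
- have [E hT1] := represents_pop0 hT hx.
  exists T => //; apply: reaches_step; rewrite /frag_step /= E hT1.
  exact: reaches_refl.
- have [E hT1] := represents_pop hT hx.
  have [T1 hT1' H1] := IH1 _ hT1; have [T2 hT2 H2] := IH2 _ hT1'; exists T2 => //.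
  apply: (reaches_trans _ H2).
  apply: reaches_step; rewrite /frag_step /= E; case: b H1 {E IH1 hx} => H.
    apply: (reaches_embed (g := frag_of (Loop x p0 p1))
              (e := fun q => Some (inr q)) (x := Some None) _ H) => q r /=.
    by case: (ftrans q r) => [[]].
  apply: (reaches_embed (g := frag_of (Loop x p0 p1))
              (e := fun q => Some (inl q)) (x := Some None) _ H) => q r /=.
  by case: (ftrans q r) => [[]].
Qed.

Definition TM_of (p : stmt) : TM :=
  @MkTM 5 (option (fstate (frag_of p))) (Some (fstart (frag_of p)))
    (fun q => q == None)
    (fun q r => if q is Some q' then ftrans q' r else (None, keep r)).

Lemma str_of_tape_of_str (s : seq bool) : str_of_tape (tape_of_str s) = s.
Proof.
case: s => //= b s; rewrite /str_of_tape /=; congr (_ :: _).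
by elim: s => //= ? ? ->.
Qed.

Lemma exec_computes p pr u s' :
  exec p (Stacks pr u [::] [::] [::] [::] [::]) s' ->
  computes (TM_of p) pr u (get s' RP).
Proof.
move=> H; have hI : represents (tm_init (TM_of p) pr u).2
    (Stacks pr u [::] [::] [::] [::] [::]).
  by move=> r; rewrite /= ffunE str_of_tape_of_str; case: r.
have [T' hT' [k Hk]] := exec_reaches H hI; exists k => /=.
have -> : forall c, iter k (@tm_step (TM_of p)) c = iter k (@frag_step (frag_of p)) c.
  move=> c; apply: eq_iter => -[[q|] T]; rewrite /tm_step /frag_step //=.
  by case: (ftrans _ _).
rewrite /tm_init /= in Hk *; rewrite Hk; split=> //=; rewrite -[sP s']/(get s' RP) -hT'.
by congr (str_of_tape (T' _)); exact: val_inj.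
Qed.
(** * A language of binary trees *)

Inductive tree := Leaf | Node of tree & tree.

(** A while language without variables: every program maps one tree to one tree, and parameters
    travel inside the tree. Closure properties thus become mere compositions of constructors. *)
Inductive code :=
  | CId | CLeaf | CFst | CSnd
  | CPair of code & code
  | CComp of code & code
  | CIf of code & code & code
  | CWhile of code & code.

Definition tfst (d : tree) := if d is Node x _ then x else Leaf.
Definition tsnd (d : tree) := if d is Node _ y then y else Leaf.
Definition is_node (d : tree) := if d is Node _ _ then true else false.

Inductive ev : code -> tree -> tree -> Prop :=
  | ev_id d : ev CId d d
  | ev_leaf d : ev CLeaf d Leaf
  | ev_fst d : ev CFst d (tfst d)
  | ev_snd d : ev CSnd d (tsnd d)
  | ev_pair c1 c2 d d1 d2 : ev c1 d d1 -> ev c2 d d2 ->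
      ev (CPair c1 c2) d (Node d1 d2)
  | ev_comp c1 c2 d d1 d2 : ev c1 d d1 -> ev c2 d1 d2 ->
      ev (CComp c2 c1) d d2
  | ev_if t c1 c2 d e d' : ev t d e -> ev (if is_node e then c1 else c2) d d' ->
      ev (CIf t c1 c2) d d'
  | ev_while0 t c d : ev t d Leaf -> ev (CWhile t c) d d
  | ev_while1 t c d x y d1 d2 : ev t d (Node x y) -> ev c d d1 ->
      ev (CWhile t c) d1 d2 -> ev (CWhile t c) d d2.

(** * Running tree programs on bit stacks *)

Fixpoint ser (d : tree) : seq bool :=
  if d is Node x y then true :: ser x ++ ser y else [:: false].

Definition mstack (m : seq bool) : stacks :=
  Stacks [::] [::] m [::] [::] [::] [::].

(** [RC] holds in unary the number of subtrees still to be read: a bit [false] of the preorder code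
    completes one, a bit [true] replaces one by two. The code arrives on [x] reversed. *)
Definition move_tree (x : reg) : stmt :=
  Seq (Push RC true)
    (Loop RC Skip
      (PopCase RM (Push x false)
         (Seq (Push x true) (Seq (Push RC true) (Push RC true))) Skip)).

Definition pour (x y : reg) : stmt := Loop x (Push y false) (Push y true).
Definition pour2 (x y z : reg) : stmt :=
  Loop x (Seq (Push y false) (Push z false)) (Seq (Push y true) (Push z true)).

Definition drop_tree : stmt := Seq (move_tree RA) (Loop RA Skip Skip).
Definition dup_tree : stmt :=
  Seq (move_tree RA) (Seq (pour2 RA RM RB) (Seq (pour RB RA) (pour RA RM))).
Definition swap_tree : stmt :=
  Seq (move_tree RA) (Seq (move_tree RB) (Seq (pour RA RM) (pour RB RM))).

(* The argument is the preorder code on top of RM, which the result replaces; all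
   other stacks are empty before and after. *)
Fixpoint stmt_of (c : code) : stmt :=
  match c with
  | CId => Skip
  | CLeaf => Seq drop_tree (Push RM false)
  | CFst => PopCase RM (Push RM false) (Seq swap_tree drop_tree) Skip
  | CSnd => PopCase RM (Push RM false) drop_tree Skip
  | CPair c1 c2 =>
      Seq dup_tree (Seq (stmt_of c2) (Seq swap_tree (Seq (stmt_of c1) (Push RM true))))
  | CComp c2 c1 => Seq (stmt_of c1) (stmt_of c2)
  | CIf t c1 c2 =>
      Seq dup_tree (Seq (stmt_of t)
        (PopCase RM (stmt_of c2)
           (Seq drop_tree (Seq drop_tree (stmt_of c1))) Skip))
  | CWhile t c =>
      Seq (Push RF true)
        (Loop RF Skip (Seq dup_tree (Seq (stmt_of t)
          (PopCase RM Skip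
            (Seq drop_tree (Seq drop_tree (Seq (stmt_of c) (Push RF true))))
            Skip))))
  end.

Lemma exec_push_eq r b s s' : s' = put s r (b :: get s r) ->
  exec (Push r b) s s'.
Proof. by move=> ->; exact: exec_push. Qed.


(** The rest of the run is a premise because the loop does not stop after one tree when [c] is
    nonempty; this lets the induction chain the two subtrees of a node. *)
Lemma move_tree_A_loop d p u m a b c f s' :
  let body := PopCase RM (Push RA false)
    (Seq (Push RA true) (Seq (Push RC true) (Push RC true))) Skip in
  exec (Loop RC Skip body) (Stacks p u m (rev (ser d) ++ a) b c f) s' ->
  exec (Loop RC Skip body) (Stacks p u (ser d ++ m) a b (true :: c) f) s'.
Proof.
move=> /=; elim: d m a c s' => [|x IHx y IHy] m a c s' H.
  apply: exec_loop; [by []| |exact: H].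
  by apply: exec_pop; [by []|exact: exec_push_eq].
apply: (exec_loop (s' := Stacks p u (ser x ++ ser y ++ m) (true :: a) b
          (true :: true :: c) f)); first by [].
  apply: exec_pop; first by rewrite /= -catA.
  apply: exec_seq; first exact: exec_push.
  by apply: exec_seq; [exact: exec_push|exact: exec_push].
apply: IHx; apply: IHy; move: H.
by rewrite /= rev_cons rev_cat -cats1 -!catA.
Qed.

Lemma move_tree_B_loop d p u m a b c f s' :
  let body := PopCase RM (Push RB false)
    (Seq (Push RB true) (Seq (Push RC true) (Push RC true))) Skip in
  exec (Loop RC Skip body) (Stacks p u m a (rev (ser d) ++ b) c f) s' ->
  exec (Loop RC Skip body) (Stacks p u (ser d ++ m) a b (true :: c) f) s'.
Proof.
move=> /=; elim: d m b c s' => [|x IHx y IHy] m b c s' H.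
  apply: exec_loop; [by []| |exact: H].
  by apply: exec_pop; [by []|exact: exec_push_eq].
apply: (exec_loop (s' := Stacks p u (ser x ++ ser y ++ m) a (true :: b)
          (true :: true :: c) f)); first by [].
  apply: exec_pop; first by rewrite /= -catA.
  apply: exec_seq; first exact: exec_push.
  by apply: exec_seq; [exact: exec_push|exact: exec_push].
apply: IHx; apply: IHy; move: H.
by rewrite /= rev_cons rev_cat -cats1 -!catA.
Qed.

Lemma exec_move_tree_A d p u m a b f :
  exec (move_tree RA) (Stacks p u (ser d ++ m) a b [::] f)
       (Stacks p u m (rev (ser d) ++ a) b [::] f).
Proof.
apply: exec_seq; first exact: exec_push.
by apply: move_tree_A_loop; apply: exec_loopN.
Qed.

Lemma exec_move_tree_B d p u m a b f :
  exec (move_tree RB) (Stacks p u (ser d ++ m) a b [::] f)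
       (Stacks p u m a (rev (ser d) ++ b) [::] f).
Proof.
apply: exec_seq; first exact: exec_push.
by apply: move_tree_B_loop; apply: exec_loopN.
Qed.

Lemma exec_pour x y l s : ord_of_reg x != ord_of_reg y -> get s x = l ->
  exec (pour x y) s (put (put s x [::]) y (rev l ++ get s y)).
Proof.
move=> nxy; elim: l s => [|b l IH] s hs.
  have -> : put (put s x [::]) y (rev [::] ++ get s y) = s.
    by case: s hs => ???????; case: x nxy => /= nxy ->; case: y nxy.
  by apply: exec_loopN.
apply: (exec_loop (b := b)); first exact: hs.
  instantiate (1 := put (put s x l) y (b :: get s y)).
  by case: b {hs}; apply: exec_push_eq; rewrite get_put eq_sym (negPf nxy).
have := IH (put (put s x l) y (b :: get s y)).
rewrite !get_put (negPf nxy) !eqxx rev_cons -cats1 -catA => /(_ erefl).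
by case: s {hs IH} => ???????; case: x nxy; case: y.
Qed.

Lemma exec_drop_tree d m f :
  exec drop_tree (Stacks [::] [::] (ser d ++ m) [::] [::] [::] f)
                 (Stacks [::] [::] m [::] [::] [::] f).
Proof.
apply: exec_seq; first exact: exec_move_tree_A.
rewrite cats0; elim: (rev _) => [|b l IH]; first exact: exec_loopN.
by apply: exec_loop IH; [by []|case: b; exact: exec_skip].
Qed.

Lemma exec_dup_tree d m f :
  exec dup_tree (Stacks [::] [::] (ser d ++ m) [::] [::] [::] f)
                (Stacks [::] [::] (ser d ++ ser d ++ m) [::] [::] [::] f).
Proof.
apply: exec_seq; first exact: exec_move_tree_A.
apply: (exec_seq (s1 := Stacks [::] [::] (ser d ++ m) [::] (ser d) [::] f)).
  have H l v w : exec (pour2 RA RM RB) (Stacks [::] [::] v l w [::] f)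
      (Stacks [::] [::] (rev l ++ v) [::] (rev l ++ w) [::] f).
    elim: l v w => [|b l IH] v w; first exact: exec_loopN.
    rewrite rev_cons -cats1 -!catA.
    apply: exec_loop (IH _ _); first by [].
    by case: b; apply: exec_seq; exact: exec_push.
  by have := H (rev (ser d)) m [::]; rewrite revK !cats0.
apply: exec_seq; first by apply: exec_pour.
have := @exec_pour RA RM (rev (ser d))
  (Stacks [::] [::] (ser d ++ m) (rev (ser d)) [::] [::] f).
by rewrite revK /= cats0; exact.
Qed.

Lemma exec_swap_tree d e m f :
  exec swap_tree (Stacks [::] [::] (ser d ++ ser e ++ m) [::] [::] [::] f)
                 (Stacks [::] [::] (ser e ++ ser d ++ m) [::] [::] [::] f).
Proof.
apply: exec_seq; first exact: exec_move_tree_A.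
apply: exec_seq; first exact: exec_move_tree_B.
rewrite !cats0.
apply: exec_seq; first by apply: exec_pour.
rewrite revK /=.
have := @exec_pour RB RM (rev (ser e))
  (Stacks [::] [::] (ser d ++ m) [::] (rev (ser e)) [::] f).
by rewrite revK /=; exact.
Qed.

Lemma ev_exec c d d' : ev c d d' ->
  forall m, exec (stmt_of c) (mstack (ser d ++ m)) (mstack (ser d' ++ m)).
Proof.
elim=> {c d d'} [d|d|d|d|c1 c2 d d1 d2 _ IH1 _ IH2|c1 c2 d d1 d2 _ IH1 _ IH2
  |t c1 c2 d e d' _ IHt _ IH|t c d _ IHt|t c d x y d1 d2 _ IHt _ IHc _ IHw] m /=.
- exact: exec_skip.
- by apply: exec_seq; [exact: exec_drop_tree|exact: exec_push].
- case: d => [|x y] /=.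
    by apply: exec_pop; [by []|exact: exec_push].
  apply: exec_pop; [by []|rewrite /= -catA].
  by apply: exec_seq; [exact: exec_swap_tree|exact: exec_drop_tree].
- case: d => [|x y] /=.
    by apply: exec_pop; [by []|exact: exec_push].
  by apply: exec_pop; [by []|rewrite /= -catA; exact: exec_drop_tree].
- apply: exec_seq; first exact: exec_dup_tree.
  apply: exec_seq; first exact: IH2.
  apply: exec_seq; first exact: exec_swap_tree.
  apply: exec_seq; first exact: IH1.
  by apply: exec_push_eq; rewrite /= catA.
- by apply: exec_seq; [exact: IH1|exact: IH2].
- apply: exec_seq; first exact: exec_dup_tree.
  apply: exec_seq; first exact: IHt.
  case: e {IHt} IH => [|x y] /= IH.
    by apply: exec_pop; [by []|exact: IH].
  apply: exec_pop; [by []|rewrite /= -catA].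
  apply: exec_seq; first exact: exec_drop_tree.
  by apply: exec_seq; [exact: exec_drop_tree|exact: IH].
- apply: exec_seq; first exact: exec_push.
  apply: exec_loop; [by []| |by apply: exec_loopN] => /=.
  apply: exec_seq; first exact: exec_dup_tree.
  apply: exec_seq; first exact: IHt.
  by apply: exec_pop; [by []|exact: exec_skip].
- apply: exec_seq; first exact: exec_push.
  apply: (exec_loop (s' := put (mstack (ser d1 ++ m)) RF [:: true])); first by [].
    apply: exec_seq; first exact: exec_dup_tree.
    apply: exec_seq; first exact: IHt.
    apply: (@exec_pop _ _ _ _ _ _ true (ser x ++ ser y ++ ser d ++ m)) => /=; first by rewrite -catA.
    apply: exec_seq; first exact: exec_drop_tree.
    apply: exec_seq; first exact: exec_drop_tree.
    by apply: exec_seq; [exact: IHc|exact: exec_push].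
  (* The induction hypothesis runs the whole statement, which begins by pushing the flag. The body
     has already restored the flag, so inversion strips that push and keeps the run of the loop. *)
  have := IHw m; move E: (mstack _) => s0; move E': (mstack _) => s1 H.
  inversion H; subst => //.
  match goal with h : exec (Push RF true) _ _ |- _ => inversion h; subst end.
  done.
Qed.

(** * Computable functions *)

Class Enc (A : Type) := enc : A -> tree.

Instance Enc_unit : Enc unit := fun=> Leaf.
Instance Enc_bool : Enc bool := fun b => if b then Node Leaf Leaf else Leaf.
Instance Enc_nat : Enc nat := fun n => iter n (Node Leaf) Leaf.
Instance Enc_prod A B `{Enc A} `{Enc B} : Enc (A * B) :=
  fun x => Node (enc x.1) (enc x.2).
Instance Enc_seq A `{Enc A} : Enc (seq A) :=
  foldr (fun a d => Node (enc a) d) Leaf.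
Instance Enc_option A `{Enc A} : Enc (option A) :=
  fun x => if x is Some a then Node (enc a) Leaf else Leaf.

Definition computable (A B : Type) {EA : Enc A} {EB : Enc B} (f : A -> B) : Prop :=
  exists c, forall a, ev c (enc a) (enc (f a)).
Arguments computable {A B EA EB} f.

(** The code of a list is written onto the stack from its last element, hence the bits are expected
    in reverse order on [x]. *)
Definition load (x : reg) : stmt :=
  Seq (Push RM false)
    (Loop x (Seq (Push RM false) (Push RM true))
       (Seq (Seq (Push RM false) (Push RM false))
            (Seq (Push RM true) (Push RM true)))).

Definition unload : stmt :=
  Seq (Seq (Push RF true)
    (Loop RF Skip
      (PopCase RM Skip
        (PopCase RM (Seq (Push RA false) (Push RF true))
           (PopCase RM
             (PopCase RM (Seq (Push RA true) (Push RF true)) Skip Skip)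
             Skip Skip) Skip) Skip))) (pour RA RP).

Lemma exec_load_A (s : seq bool) p u m b c f :
  exec (load RA) (Stacks p u m (rev s) b c f)
       (Stacks p u (ser (enc s) ++ m) [::] b c f).
Proof.
have H l t : exec (Loop RA (Seq (Push RM false) (Push RM true))
       (Seq (Seq (Push RM false) (Push RM false))
            (Seq (Push RM true) (Push RM true))))
    (Stacks p u (ser (enc t) ++ m) l b c f)
    (Stacks p u (ser (enc (rev l ++ t)) ++ m) [::] b c f).
  elim: l t => [|e l IH] t; first exact: exec_loopN.
  rewrite rev_cons -cats1 -catA; apply: exec_loop (IH _); first by [].
  by case: e; repeat (apply: exec_seq); exact: exec_push.
apply: exec_seq; first exact: exec_push.
by have := H (rev s) [::]; rewrite revK cats0.
Qed.

Lemma exec_load_B (s : seq bool) p u m a c f :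
  exec (load RB) (Stacks p u m a (rev s) c f)
       (Stacks p u (ser (enc s) ++ m) a [::] c f).
Proof.
have H l t : exec (Loop RB (Seq (Push RM false) (Push RM true))
       (Seq (Seq (Push RM false) (Push RM false))
            (Seq (Push RM true) (Push RM true))))
    (Stacks p u (ser (enc t) ++ m) a l c f)
    (Stacks p u (ser (enc (rev l ++ t)) ++ m) a [::] c f).
  elim: l t => [|e l IH] t; first exact: exec_loopN.
  rewrite rev_cons -cats1 -catA; apply: exec_loop (IH _); first by [].
  by case: e; repeat (apply: exec_seq); exact: exec_push.
apply: exec_seq; first exact: exec_push.
by have := H (rev s) [::]; rewrite revK cats0.
Qed.

Lemma exec_unload (s : seq bool) :
  exec unload (mstack (ser (enc s))) (Stacks s [::] [::] [::] [::] [::] [::]).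
Proof.
apply: (exec_seq (s1 := Stacks [::] [::] [::] (rev s) [::] [::] [::])); last first.
  have := @exec_pour RA RP (rev s) (Stacks [::] [::] [::] (rev s) [::] [::] [::]).
  by rewrite revK /= cats0; exact.
apply: exec_seq; first exact: exec_push.
have H t a : exec (Loop RF Skip
      (PopCase RM Skip
        (PopCase RM (Seq (Push RA false) (Push RF true))
           (PopCase RM
             (PopCase RM (Seq (Push RA true) (Push RF true)) Skip Skip)
             Skip Skip) Skip) Skip))
    (Stacks [::] [::] (ser (enc t)) a [::] [::] [:: true])
    (Stacks [::] [::] [::] (rev t ++ a) [::] [::] [::]).
  elim: t a => [|e t IH] a.
    apply: exec_loop; [by []| |by apply: exec_loopN].
    by apply: exec_pop; [by []|exact: exec_skip].
  rewrite rev_cons -cats1 -catA; apply: exec_loop (IH _); first by [].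
  apply: (@exec_pop _ _ _ _ _ _ true (ser (enc e) ++ ser (enc t))); first by [].
  case: e => /=.
    do 3![apply: exec_pop; first by []].
    by apply: exec_seq; exact: exec_push.
  by apply: exec_pop; [by []|apply: exec_seq; exact: exec_push].
by have := H s [::]; rewrite cats0.
Qed.

Definition main_stmt (c : code) : stmt :=
  Seq (Seq (Seq (pour RP RA) (pour RU RB))
           (Seq (Seq (load RB) (load RA)) (Push RM true)))
      (Seq (stmt_of c) unload).

Lemma ev_computes c (p u x : seq bool) : ev c (enc (p, u)) (enc x) ->
  computes (TM_of (main_stmt c)) p u x.
Proof.
move=> H; apply: (@exec_computes _ p u (Stacks x [::] [::] [::] [::] [::] [::])).
apply: (exec_seq (s1 := mstack (ser (enc (p, u))))); last first.
  by apply: exec_seq; [rewrite -[ser _]cats0; exact: ev_exec H _|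
                       rewrite cats0; exact: exec_unload].
apply: exec_seq.
  by apply: exec_seq; exact: exec_pour.
rewrite /= !cats0.
apply: (exec_seq (s1 := mstack (ser (enc p) ++ ser (enc u)))); last exact: exec_push.
apply: exec_seq; first exact: exec_load_B.
by rewrite cats0; exact: exec_load_A.
Qed.

Lemma comp_ext A B `{Enc A} `{Enc B} (f g : A -> B) : f =1 g -> computable f -> computable g.
Proof. by move=> e [c hc]; exists c => a; rewrite -e. Qed.

Lemma comp_enc A B `{Enc A} `{Enc B} (f : A -> B) :
  (forall a, enc (f a) = enc a) -> computable f.
Proof. by move=> e; exists CId => a; rewrite e; exact: ev_id. Qed.

Lemma comp_id A `{Enc A} : computable (fun a : A => a).
Proof. exact: comp_enc. Qed.

Fixpoint const_code (d : tree) : code :=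
  if d is Node x y then CPair (const_code x) (const_code y) else CLeaf.

Lemma ev_const d e : ev (const_code d) e d.
Proof.
by elim: d => [|x IHx y IHy] /=; [exact: ev_leaf|exact: ev_pair].
Qed.

Lemma comp_const A B `{Enc A} `{Enc B} (b : B) : computable (fun _ : A => b).
Proof. by exists (const_code (enc b)) => a; exact: ev_const. Qed.

Lemma comp_o A B C `{Enc A} `{Enc B} `{Enc C} (g : B -> C) (f : A -> B) :
  computable g -> computable f -> computable (fun a => g (f a)).
Proof.
by move=> [cg hg] [cf hf]; exists (CComp cg cf) => a; exact: ev_comp (hf a) (hg _).
Qed.

Lemma comp_pair A B C `{Enc A} `{Enc B} `{Enc C} (f : A -> B) (g : A -> C) :
  computable f -> computable g -> computable (fun a => (f a, g a)).
Proof.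
by move=> [cf hf] [cg hg]; exists (CPair cf cg) => a; exact: ev_pair (hf a) (hg a).
Qed.

Lemma comp_o2 A B C D `{Enc A} `{Enc B} `{Enc C} `{Enc D} (g : B -> C -> D)
    (f1 : A -> B) (f2 : A -> C) :
  computable (fun x : B * C => g x.1 x.2) -> computable f1 -> computable f2 ->
  computable (fun a => g (f1 a) (f2 a)).
Proof. by move=> hg h1 h2; exact: (comp_o hg (comp_pair h1 h2)). Qed.

Lemma comp_o3 A B C D F `{Enc A} `{Enc B} `{Enc C} `{Enc D} `{Enc F}
    (g : B -> C -> D -> F) (f1 : A -> B) (f2 : A -> C) (f3 : A -> D) :
  computable (fun x : (B * C) * D => g x.1.1 x.1.2 x.2) ->
  computable f1 -> computable f2 -> computable f3 ->
  computable (fun a => g (f1 a) (f2 a) (f3 a)).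
Proof. by move=> hg h1 h2 h3; exact: (comp_o hg (comp_pair (comp_pair h1 h2) h3)). Qed.

Lemma comp_fst A B C `{Enc A} `{Enc B} `{Enc C} (f : A -> B * C) :
  computable f -> computable (fun a => (f a).1).
Proof.
by move=> [c h]; exists (CComp CFst c) => a; exact: ev_comp (h a) (ev_fst _).
Qed.

Lemma comp_snd A B C `{Enc A} `{Enc B} `{Enc C} (f : A -> B * C) :
  computable f -> computable (fun a => (f a).2).
Proof.
by move=> [c h]; exists (CComp CSnd c) => a; exact: ev_comp (h a) (ev_snd _).
Qed.

Lemma comp_if A B `{Enc A} `{Enc B} (b : A -> bool) (f g : A -> B) :
  computable b -> computable f -> computable g -> computable (fun a => if b a then f a else g a).
Proof.
move=> [cb hb] [cf hf] [cg hg]; exists (CIf cb cf cg) => a.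
by apply: ev_if (hb a) _; case: (b a); [exact: hf|exact: hg].
Qed.

Lemma comp_cons A B `{Enc A} `{Enc B} (f : A -> B) (g : A -> seq B) :
  computable f -> computable g -> computable (fun a => f a :: g a).
Proof.
by move=> [cf hf] [cg hg]; exists (CPair cf cg) => a; exact: ev_pair (hf a) (hg a).
Qed.

Lemma comp_Some A B `{Enc A} `{Enc B} (f : A -> B) :
  computable f -> computable (fun a => Some (f a)).
Proof.
by move=> [c h]; exists (CPair c CLeaf) => a; exact: ev_pair (h a) (ev_leaf _).
Qed.

Lemma comp_succn A `{Enc A} (f : A -> nat) : computable f -> computable (fun a => (f a).+1).
Proof.
by move=> [c h]; exists (CPair CLeaf c) => a; exact: ev_pair (ev_leaf _) (h a).
Qed.

Lemma comp_case_seq A B C `{Enc A} `{Enc B} `{Enc C} (l : A -> seq B)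
    (f : A -> C) (g : A -> B -> seq B -> C) :
  computable l -> computable f -> computable (fun x : A * (B * seq B) => g x.1 x.2.1 x.2.2) ->
  computable (fun a => match l a with [::] => f a | x :: s => g a x s end).
Proof.
move=> [cl hl] [cf hf] [cg hg].
exists (CIf cl (CComp cg (CPair CId cl)) cf) => a.
apply: ev_if (hl a) _; move: (hl a); case: (l a) => [|x s] hla; first exact: hf.
by apply: ev_comp (hg (a, (x, s))); exact: ev_pair (ev_id _) hla.
Qed.

Lemma comp_case_option A B C `{Enc A} `{Enc B} `{Enc C} (l : A -> option B)
    (f : A -> C) (g : A -> B -> C) :
  computable l -> computable f -> computable (fun x : A * B => g x.1 x.2) ->
  computable (fun a => match l a with Some x => g a x | None => f a end).
Proof.
move=> [cl hl] [cf hf] [cg hg].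
exists (CIf cl (CComp cg (CPair CId (CComp CFst cl))) cf) => a.
apply: ev_if (hl a) _; move: (hl a); case: (l a) => [x|] hla; last exact: hf.
apply: ev_comp (hg (a, x)); apply: ev_pair (ev_id _) _.
exact: ev_comp hla (ev_fst _).
Qed.

Lemma comp_case_nat A C `{Enc A} `{Enc C} (n : A -> nat)
    (f : A -> C) (g : A -> nat -> C) :
  computable n -> computable f -> computable (fun x : A * nat => g x.1 x.2) ->
  computable (fun a => match n a with 0 => f a | m.+1 => g a m end).
Proof.
move=> [cl hl] [cf hf] [cg hg].
exists (CIf cl (CComp cg (CPair CId (CComp CSnd cl))) cf) => a.
apply: ev_if (hl a) _; move: (hl a); case: (n a) => [|x] hla; first exact: hf.
apply: ev_comp (hg (a, x)); apply: ev_pair (ev_id _) _.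
exact: ev_comp hla (ev_snd _).
Qed.

Lemma comp_foldl A B S `{Enc A} `{Enc B} `{Enc S} (F : A -> S -> B -> S)
    (i : A -> S) (l : A -> seq B) :
  computable (fun x : A * (S * B) => F x.1 x.2.1 x.2.2) -> computable i -> computable l ->
  computable (fun a => foldl (F a) (i a) (l a)).
Proof.
move=> [cF hF] [ci hi] [cl hl].
(* The loop state is the triple of the remaining list, the accumulator and the parameter [a]. *)
pose acc := CComp CFst CSnd; pose par := CComp CSnd CSnd.
pose step := CPair (CComp CSnd CFst)
  (CPair (CComp cF (CPair par (CPair acc (CComp CFst CFst)))) par).
exists (CComp acc (CComp (CWhile CFst step) (CPair cl (CPair ci CId)))) => a.
apply: ev_comp.
  apply: ev_comp; first exact: ev_pair (hl a) (ev_pair (hi a) (ev_id _)).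
  instantiate (1 := enc ([::] : seq B, (foldl (F a) (i a) (l a), a))).
  elim: (l a) (i a) => [|b s IH] z; first by apply: ev_while0; exact: (ev_fst (Node _ _)).
  apply: ev_while1; [exact: (ev_fst (Node _ _))| |exact: IH].
  have hpar : ev par (Node (enc (b :: s)) (Node (enc z) (enc a))) (enc a).
    exact: ev_comp (ev_snd _) (ev_snd _).
  apply: ev_pair; first exact: ev_comp (ev_fst _) (ev_snd _).
  apply: ev_pair => //; apply: ev_comp (hF (a, (z, b))).
  apply: ev_pair => //; apply: ev_pair; first exact: ev_comp (ev_snd _) (ev_fst _).
  exact: ev_comp (ev_fst _) (ev_fst _).
exact: ev_comp (ev_snd _) (ev_fst _).
Qed.

Lemma comp_iter A S `{Enc A} `{Enc S} (F : A -> S -> S) (n : A -> nat) (i : A -> S) :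
  computable (fun x : A * S => F x.1 x.2) -> computable n -> computable i ->
  computable (fun a => iter (n a) (F a) (i a)).
Proof.
move=> hF hn hi.
apply: (@comp_ext _ _ _ _ (fun a => foldl (fun z (_ : unit) => F a z) (i a) (nseq (n a) tt))).
  move=> a; elim: (n a) (i a) => // k IH z; rewrite iterSr -IH //.
apply: comp_foldl hi _.
  exact: (comp_o hF (comp_pair (comp_fst (@comp_id _ _)) (comp_fst (comp_snd (@comp_id _ _))))).
(* A number has the same encoding as a list of that many units, so the code that computes the number
   also computes the list. *)
case: hn => c hc; exists c => a; move: (hc a); congr (ev _ _ _).
by elim: (n a) => // k IH; exact: (congr1 (Node Leaf) IH).
Qed.

Lemma comp_rev A B `{Enc A} `{Enc B} (l : A -> seq B) :
  computable l -> computable (fun a => rev (l a)).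
Proof.
move=> hl.
apply: (@comp_ext _ _ _ _ (fun a => foldl (fun s b => b :: s) [::] (l a))).
  by move=> a; rewrite /rev; elim: (l a) (nil : seq B) => //= b s IH t.
apply: comp_foldl hl; last exact: comp_const.
by apply: comp_cons; [exact: comp_snd (comp_snd (@comp_id _ _))|
  exact: comp_fst (comp_snd (@comp_id _ _))].
Qed.

Lemma comp_foldr A B S `{Enc A} `{Enc B} `{Enc S} (F : A -> B -> S -> S)
    (i : A -> S) (l : A -> seq B) :
  computable (fun x : A * (B * S) => F x.1 x.2.1 x.2.2) -> computable i -> computable l ->
  computable (fun a => foldr (F a) (i a) (l a)).
Proof.
move=> hF hi hl.
apply: (@comp_ext _ _ _ _ (fun a => foldl (fun z b => F a b z) (i a) (rev (l a)))).
  by move=> a; rewrite foldl_rev.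
apply: comp_foldl hi (comp_rev hl).
have I : computable (fun x : A * (S * B) => x) by exact: comp_id.
have J := comp_pair (comp_fst I) (comp_pair (comp_snd (comp_snd I)) (comp_fst (comp_snd I))).
exact (comp_o hF J).
Qed.

(* Redefined as further closure lemmas become available. *)
Ltac comp_user := fail.

(** Follows the syntax of the function body. A variable function of two or three arguments is
    treated through a hypothesis on its uncurried form. *)
Ltac comp_step :=
  match goal with
  | |- computable (fun a => a) => apply comp_id
  | |- computable (fun a => ?b) => apply comp_const
  | |- computable _ => assumption
  | |- @computable ?A ?B ?EA ?EB ?f =>
      lazymatch f with
      | fun _ => _ => fail
      | _ => change (@computable A B EA EB (fun a => f a))
      end
  | H : computable (fun x => ?F (fst x) (snd x)) |- computable (fun a => ?F _ _) =>
      is_var F; refine (comp_o2 (g := F) H _ _)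
  | H : computable (fun x => ?F (fst (fst x)) (snd (fst x)) (snd x))
      |- computable (fun a => ?F _ _ _) =>
      is_var F; refine (comp_o3 (g := F) H _ _ _)
  | H : computable ?f |- computable (fun a => ?f _) => is_var f; refine (comp_o H _)
  | |- computable (fun a => fst _) => refine (comp_fst _)
  | |- computable (fun a => snd _) => refine (comp_snd _)
  | |- computable (fun a => (_, _)) => refine (comp_pair _ _)
  | |- computable (fun a => _ :: _) => refine (comp_cons _ _)
  | |- computable (fun a => Some _) => refine (comp_Some _)
  | |- computable (fun a => S _) => refine (comp_succn _)
  | |- computable (fun a => foldl _ _ _) => refine (comp_foldl _ _ _)
  | |- computable (fun a => foldr _ _ _) => refine (comp_foldr _ _ _)
  | |- computable (fun a => iter _ _ _) => refine (comp_iter _ _ _)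
  | |- computable (fun a => rev _) => refine (comp_rev _)
  | |- computable (fun a => if _ then _ else _) => refine (comp_if _ _ _)
  | |- computable (fun a => match _ with [::] => _ | _ :: _ => _ end) => refine (comp_case_seq _ _ _)
  | |- computable (fun a => match _ with Some _ => _ | None => _ end) => refine (comp_case_option _ _ _)
  | |- computable (fun a => match _ with O => _ | S _ => _ end) => refine (comp_case_nat _ _ _)
  | _ => comp_user
  end.

Ltac comp_tac := repeat (cbv beta zeta; comp_step).

Lemma comp_map A B C `{Enc A} `{Enc B} `{Enc C} (F : A -> B -> C) (l : A -> seq B) :
  computable (fun x : A * B => F x.1 x.2) -> computable l ->
  computable (fun a => [seq F a b | b <- l a]).
Proof.
move=> hF hl.
apply: (@comp_ext _ _ _ _ (fun a => foldr (fun b s => F a b :: s) [::] (l a))).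
  by move=> a; elim: (l a) => //= b s ->.
comp_tac.
Qed.

Lemma comp_filter A B `{Enc A} `{Enc B} (F : A -> B -> bool) (l : A -> seq B) :
  computable (fun x : A * B => F x.1 x.2) -> computable l ->
  computable (fun a => [seq b <- l a | F a b]).
Proof.
move=> hF hl.
apply: (@comp_ext _ _ _ _ (fun a => foldr (fun b s => if F a b then b :: s else s) [::] (l a))).
  by move=> a; elim: (l a) => //= b s ->.
comp_tac.
Qed.

Lemma comp_has A B `{Enc A} `{Enc B} (F : A -> B -> bool) (l : A -> seq B) :
  computable (fun x : A * B => F x.1 x.2) -> computable l -> computable (fun a => has (F a) (l a)).
Proof.
move=> hF hl.
apply: (@comp_ext _ _ _ _ (fun a => foldr (fun b s => if F a b then true else s) false (l a))).
  by move=> a; elim: (l a) => //= b s ->; case: (F a b).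
comp_tac.
Qed.

Lemma comp_all A B `{Enc A} `{Enc B} (F : A -> B -> bool) (l : A -> seq B) :
  computable (fun x : A * B => F x.1 x.2) -> computable l -> computable (fun a => all (F a) (l a)).
Proof.
move=> hF hl.
apply: (@comp_ext _ _ _ _ (fun a => foldr (fun b s => if F a b then s else false) true (l a))).
  by move=> a; elim: (l a) => //= b s ->; case: (F a b).
comp_tac.
Qed.

Lemma comp_pmap A B C `{Enc A} `{Enc B} `{Enc C} (F : A -> B -> option C) (l : A -> seq B) :
  computable (fun x : A * B => F x.1 x.2) -> computable l -> computable (fun a => pmap (F a) (l a)).
Proof.
move=> hF hl.
apply: (@comp_ext _ _ _ _ (fun a =>
    foldr (fun b s => if F a b is Some c then c :: s else s) [::] (l a))).
  by move=> a; elim: (l a) => //= b s ->; case: (F a b).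
comp_tac.
Qed.

Lemma comp_size A B `{Enc A} `{Enc B} (l : A -> seq B) :
  computable l -> computable (fun a => size (l a)).
Proof.
move=> hl; apply: (@comp_ext _ _ _ _ (fun a => foldr (fun _ n => n.+1) 0 (l a))).
  by move=> a; elim: (l a) => //= b s ->.
comp_tac.
Qed.

Lemma comp_cat A B `{Enc A} `{Enc B} (l s : A -> seq B) :
  computable l -> computable s -> computable (fun a => l a ++ s a).
Proof.
move=> hl hs; apply: (@comp_ext _ _ _ _ (fun a => foldr cons (s a) (l a))).
  by move=> a; elim: (l a) => //= b t ->.
comp_tac.
Qed.

Lemma comp_flatten A B `{Enc A} `{Enc B} (l : A -> seq (seq B)) :
  computable l -> computable (fun a => flatten (l a)).
Proof.
by move=> hl; apply: comp_foldr => //; [refine (comp_cat _ _); comp_tac|comp_tac].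
Qed.

Lemma comp_behead A B `{Enc A} `{Enc B} (l : A -> seq B) :
  computable l -> computable (fun a => behead (l a)).
Proof. move=> hl; rewrite /behead; comp_tac. Qed.

Lemma comp_head A B `{Enc A} `{Enc B} (x : A -> B) (l : A -> seq B) :
  computable x -> computable l -> computable (fun a => head (x a) (l a)).
Proof. move=> hx hl; rewrite /head; comp_tac. Qed.

Lemma comp_nth A B `{Enc A} `{Enc B} (x : A -> B) (l : A -> seq B) (n : A -> nat) :
  computable x -> computable l -> computable n -> computable (fun a => nth (x a) (l a) (n a)).
Proof.
move=> hx hl hn.
apply: (@comp_ext _ _ _ _ (fun a => head (x a) (iter (n a) behead (l a)))).
  move=> a; elim: (n a) (l a) => [|k IH] s; first by rewrite nth0.
  by rewrite iterSr IH nth_behead.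
by refine (comp_head _ _) => //; comp_tac; refine (comp_behead _); comp_tac.
Qed.

Lemma comp_predn A `{Enc A} (n : A -> nat) : computable n -> computable (fun a => (n a).-1).
Proof. move=> hn; rewrite /predn; comp_tac. Qed.

Lemma comp_addn A `{Enc A} (m n : A -> nat) :
  computable m -> computable n -> computable (fun a => m a + n a).
Proof.
move=> hm hn; apply: (@comp_ext _ _ _ _ (fun a => iter (m a) S (n a))).
  by move=> a; elim: (m a) => //= k ->.
comp_tac.
Qed.

Lemma comp_leq A `{Enc A} (m n : A -> nat) :
  computable m -> computable n -> computable (fun a => m a <= n a).
Proof.
move=> hm hn; apply: (@comp_ext _ _ _ _ (fun a =>
   match iter (n a) predn (m a) with 0 => true | _.+1 => false end)).
  move=> a; have -> : iter (n a) predn (m a) = m a - n a.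
    by elim: (n a) => [|k IH] /=; rewrite ?subn0 // IH subnS.
  by rewrite /leq; case: (_ - _).
comp_tac; refine (comp_predn _); comp_tac.
Qed.

Lemma comp_pow2 A `{Enc A} (n : A -> nat) : computable n -> computable (fun a => 2 ^ n a).
Proof.
move=> hn; apply: (@comp_ext _ _ _ _ (fun a => iter (n a) (fun k => k + k) 1)).
  by move=> a; elim: (n a) => //= k ->; rewrite expnS mul2n addnn.
comp_tac; refine (comp_addn _ _); comp_tac.
Qed.

Lemma comp_andb A `{Enc A} (m n : A -> bool) :
  computable m -> computable n -> computable (fun a => m a && n a).
Proof. move=> hm hn; rewrite /andb; comp_tac. Qed.

Lemma comp_negb A `{Enc A} (m : A -> bool) : computable m -> computable (fun a => ~~ m a).
Proof. move=> hm; rewrite /negb; comp_tac. Qed.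

Class CompEq (A : eqType) {EA : Enc A} :=
  comp_eq_base : computable (fun x : A * A => x.1 == x.2).
Arguments CompEq A {EA}.

Instance CompEq_bool : CompEq bool.
Proof.
apply: (@comp_ext _ _ _ _ (fun x : bool * bool => if x.1 then x.2 else if x.2 then false else true)).
  by case=> [[] []].
comp_tac.
Qed.

Lemma comp_eq A (B : eqType) `{Enc A} `{CompEq B} (f g : A -> B) :
  computable f -> computable g -> computable (fun a => f a == g a).
Proof. by move=> hf hg; exact: (comp_o comp_eq_base (comp_pair hf hg)). Qed.

Instance CompEq_prod (A B : eqType) `{CompEq A} `{CompEq B} : CompEq (A * B)%type.
Proof.
apply: (@comp_ext _ _ _ _ (fun x : (A * B) * (A * B) =>
   (x.1.1 == x.2.1) && (x.1.2 == x.2.2))).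
  by move=> [[a b] [c d]]; rewrite /= xpair_eqE.
by refine (comp_andb _ _); refine (comp_eq _ _); comp_tac.
Qed.

Instance CompEq_seq (A : eqType) `{CompEq A} : CompEq (seq A).
Proof.
(* One pass over the first list consumes the second. The lists are equal when all comparisons
   succeeded and nothing of the second is left; running out of it early sets the flag to [false] for
   good. *)
pose F (z : bool * seq A) (b : A) :=
  if z.2 is c :: s then (z.1 && (b == c), s) else (false, [::]).
apply: (@comp_ext _ _ _ _ (fun x : seq A * seq A =>
   let z := foldl F (true, x.2) x.1 in if z.2 is _ :: _ then false else z.1)).
  move=> [s t] /=.
  have F0 l : foldl F (false, [::]) l = (false, [::]) by elim: l => //= ? ? ->.
  have -> : forall s t b, foldl F (b, t) s = 
      if size s <= size t then (b && (s == take (size s) t), drop (size s) t)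
      else (false, [::]).
    elim=> [|a l IH] [|c u] b /=; rewrite ?take0 ?drop0 ?eqxx ?andbT //.
    by rewrite /F /= IH ltnS eqseq_cons andbA.
  case: leqP => hs /=; last first.
    by apply/esym/negP => /eqP e; rewrite e ltnn in hs.
  case E: (drop _ _) => [|b l].
    rewrite take_oversize //; have := congr1 size E; rewrite size_drop /=; lia.
  apply/esym/negP => /eqP e; move: E; rewrite e drop_size //.
rewrite /F; comp_tac; refine (comp_andb _ _); comp_tac; refine (comp_eq _ _); comp_tac.
Qed.

Lemma comp_in A (B : eqType) `{Enc A} `{CompEq B} (f : A -> B) (l : A -> seq B) :
  computable f -> computable l -> computable (fun a => f a \in l a).
Proof.
move=> hf hl; apply: (@comp_ext _ _ _ _ (fun a => has (fun b => b == f a) (l a))).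
  by move=> a; exact: has_pred1.
refine (comp_has _ _) => //; refine (comp_eq _ _); comp_tac.
Qed.

Lemma comp_undup A (B : eqType) `{Enc A} `{CompEq B} (l : A -> seq B) :
  computable l -> computable (fun a => undup (l a)).
Proof.
move=> hl; apply: (@comp_ext _ _ _ _ (fun a =>
   foldr (fun b s => if b \in s then s else b :: s) [::] (l a))).
  by move=> a; elim: (l a) => //= b s ->; rewrite mem_undup.
comp_tac; refine (comp_in _ _); comp_tac.
Qed.

Lemma comp_index A (B : eqType) `{Enc A} `{CompEq B} (f : A -> B) (l : A -> seq B) :
  computable f -> computable l -> computable (fun a => index (f a) (l a)).
Proof.
move=> hf hl; apply: (@comp_ext _ _ _ _ (fun a =>
   foldr (fun b n => if b == f a then 0 else n.+1) 0 (l a))).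
  by move=> a; elim: (l a) => //= b s ->.
comp_tac; refine (comp_eq _ _); comp_tac.
Qed.

Ltac comp_lib :=
  match goal with
  | |- computable (fun a => map _ _) => refine (comp_map _ _)
  | |- computable (fun a => filter _ _) => refine (comp_filter _ _)
  | |- computable (fun a => has _ _) => refine (comp_has _ _)
  | |- computable (fun a => all _ _) => refine (comp_all _ _)
  | |- computable (fun a => pmap _ _) => refine (comp_pmap _ _)
  | |- computable (fun a => size _) => refine (comp_size _)
  | |- computable (fun a => _ ++ _) => refine (comp_cat _ _)
  | |- computable (fun a => flatten _) => refine (comp_flatten _)
  | |- computable (fun a => behead _) => refine (comp_behead _)
  | |- computable (fun a => head _ _) => refine (comp_head _ _)
  | |- computable (fun a => nth _ _ _) => refine (comp_nth _ _ _)
  | |- computable (fun a => predn _) => refine (comp_predn _)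
  | |- computable (fun a => addn _ _) => refine (comp_addn _ _)
  | |- computable (fun a => leq _ _) => refine (comp_leq _ _)
  | |- computable (fun a => expn 2 _) => refine (comp_pow2 _)
  | |- computable (fun a => andb _ _) => refine (comp_andb _ _)
  | |- computable (fun a => negb _) => refine (comp_negb _)
  | |- computable (fun a => eq_op _ _) => refine (comp_eq _ _)
  | |- computable (fun a => in_mem _ _) => refine (comp_in _ _)
  | |- computable (fun a => undup _) => refine (comp_undup _)
  | |- computable (fun a => index _ _) => refine (comp_index _ _)
  end.

Ltac comp_user ::= comp_lib.


(** * Bounded simulation of a Turing machine *)

Fixpoint eq_code (d : tree) : code :=
  if d is Node x y then
    CIf CId (CIf (CComp (eq_code x) CFst) (CComp (eq_code y) CSnd) CLeaf) CLeaf
  else CIf CId CLeaf (CPair CLeaf CLeaf).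

Lemma ev_eq_code d e :
  exists2 r, ev (eq_code d) e r & (is_node r <-> e = d).
Proof.
elim: d e => [|x IHx y IHy] [|x' y'] /=.
- exists (Node Leaf Leaf) => //; apply: ev_if; first exact: ev_id.
  exact: ev_pair (ev_leaf _) (ev_leaf _).
- exists Leaf => //; apply: ev_if; [exact: ev_id|exact: ev_leaf].
- exists Leaf => //; apply: ev_if; [exact: ev_id|exact: ev_leaf].
- have [rx hx ex] := IHx x'; have [ry hy ey] := IHy y'.
  exists (if is_node rx then ry else Leaf).
    apply: ev_if; first exact: ev_id.
    apply: ev_if; first exact: ev_comp (ev_fst (Node x' y')) hx.
    by case: (is_node rx); [exact: ev_comp (ev_snd (Node x' y')) hy|exact: ev_leaf].
  case: (is_node rx) ex => ex; split=> //.
  + by move/ey => ->; rewrite (ex.1 isT).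
  + by case=> _; apply: ey.2.
  + by case=> e _; have := ex.2 e.
Qed.

(** A lookup table: a cascade of tests against all elements of [A]. This makes the transition
    function and the halting predicate of an arbitrary machine computable. *)
Lemma comp_finite (A : finType) B `{Enc A} `{Enc B} (f : A -> B) :
  injective (enc : A -> tree) -> computable f.
Proof.
move=> inj.
exists (foldr (fun a c => CIf (eq_code (enc a)) (const_code (enc (f a))) c) CLeaf (enum A)) => a.
have : a \in enum A by rewrite mem_enum.
elim: (enum A) => // b l IH; rewrite inE => h /=.
have [r hr er] := ev_eq_code (enc b) (enc a).
apply: ev_if hr _; case E: (is_node r) er => er.
  by have /inj -> := er.1 isT; exact: ev_const.
by apply: IH; case/orP: h => // /eqP e; case: er => _; rewrite e => /(_ erefl).
Qed.

Instance Enc_state (M : TM) : Enc (tm_state M) := fun q => enc (index q (enum (tm_state M))).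
Instance Enc_ffun k A `{Enc A} : Enc {ffun 'I_k -> A} :=
  fun f => enc [seq f i | i <- enum 'I_k].
Instance Enc_symbol : Enc symbol := @Enc_option bool _.
Instance Enc_move : Enc move := fun m =>
  enc (match m with MoveLeft => None | Stay => Some false | MoveRight => Some true end).
Instance Enc_tape : Enc tape := fun t => enc (tleft t, (tcur t, tright t)).

Lemma enc_nat_inj : injective (enc : nat -> tree).
Proof.
elim=> [|m IH] [|n] //= h; congr _.+1; apply: IH.
by move: h; rewrite /enc /= => -[].
Qed.

Lemma enc_state_inj M : injective (enc : tm_state M -> tree).
Proof.
move=> p q /enc_nat_inj; apply: (@index_inj _ p); by rewrite mem_enum.
Qed.

Lemma enc_symbol_inj : injective (enc : option bool -> tree).
Proof. by move=> [[]|] [[]|]. Qed.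

Lemma enc_ffun_inj k A `{Enc A} :
  injective (enc : A -> tree) -> injective (enc : {ffun 'I_k -> A} -> tree).
Proof.
move=> inj f g h; apply/ffunP => i.
suff : {in enum 'I_k, f =1 g} by apply; rewrite mem_enum.
apply/eq_in_map; move: h; rewrite [X in X = _]/enc [X in _ = X]/enc /Enc_ffun.
elim: (enum 'I_k) => //= j l IH; rewrite [X in X = _]/enc [X in _ = X]/enc /=.
by case=> /inj -> /IH ->.
Qed.

Lemma comp_ffun k A B `{Enc A} `{Enc B} (F : 'I_k -> A -> B) :
  (forall i, computable (F i)) -> computable (fun a => [ffun i => F i a]).
Proof.
move=> h; have [c hc] : computable (fun a => [seq F i a | i <- enum 'I_k]).
  elim: (enum 'I_k) => [|i l IH] /=; [exact: comp_const|exact: comp_cons].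
exists c => a; move: (hc a); congr (ev _ _ _).
by congr (enc _); apply: eq_map => i; rewrite ffunE.
Qed.

Lemma comp_ffun_app k A B `{Enc A} `{Enc B} (g : A -> {ffun 'I_k -> B}) (i : 'I_k) :
  computable g -> computable (fun a => g a i).
Proof.
(* [nth] needs a default in [B]; if [B] is empty then so is [A], and any code will do. *)
case: (pselect (exists b : B, True)) => [[b0 _]|nB]; last first.
  by exists CLeaf => a; case: nB; exists (g a i).
move=> [c hc].
have {}hc : computable (fun a => [seq g a i | i <- enum 'I_k]) by exists c.
apply: (@comp_ext _ _ _ _ (fun a => nth b0 [seq g a i | i <- enum 'I_k] i)).
  by move=> a; rewrite (nth_map i) ?nth_ord_enum // size_enum_ord.
by apply: comp_nth => //; exact: comp_const.
Qed.

Lemma comp_tape A `{Enc A} (l r : A -> seq symbol) (c : A -> symbol) :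
  computable l -> computable c -> computable r ->
  computable (fun a => Tape (l a) (c a) (r a)).
Proof. by move=> hl hc hr; exact: (comp_pair hl (comp_pair hc hr)). Qed.

Lemma comp_tleft A `{Enc A} (t : A -> tape) : computable t -> computable (fun a => tleft (t a)).
Proof.
move=> [c h]; apply: (@comp_fst _ _ (symbol * seq symbol)%type _ _ _
  (fun a => (tleft (t a), (tcur (t a), tright (t a))))); by exists c.
Qed.

Lemma comp_tcur A `{Enc A} (t : A -> tape) : computable t -> computable (fun a => tcur (t a)).
Proof.
move=> [c h]; apply: (@comp_fst _ _ (seq symbol)%type _ _ _ (fun a => (tcur (t a), tright (t a)))).
apply: (@comp_snd _ (seq symbol) _ _ _ _
  (fun a => (tleft (t a), (tcur (t a), tright (t a))))); by exists c.
Qed.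

Lemma comp_tright A `{Enc A} (t : A -> tape) : computable t -> computable (fun a => tright (t a)).
Proof.
move=> [c h]; apply: (@comp_snd _ symbol _ _ _ _ (fun a => (tcur (t a), tright (t a)))).
apply: (@comp_snd _ (seq symbol) _ _ _ _
  (fun a => (tleft (t a), (tcur (t a), tright (t a))))); by exists c.
Qed.

Lemma comp_case_move A B `{Enc A} `{Enc B} (m : A -> move) (f g h : A -> B) :
  computable m -> computable f -> computable g -> computable h ->
  computable (fun a => match m a with MoveLeft => f a | Stay => g a | MoveRight => h a end).
Proof.
move=> [c hc] hf hg hh.
pose o a := match m a with MoveLeft => None | Stay => Some false | MoveRight => Some true end.
have ho : computable o by exists c.
apply: (@comp_ext _ _ _ _ (fun a => if o a is Some b then if b then h a else g a else f a)).
  by move=> a; rewrite /o; case: (m a).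
comp_tac.
Qed.

Ltac comp_tm :=
  match goal with
  | |- computable (fun a => tleft _) => refine (comp_tleft _)
  | |- computable (fun a => tright _) => refine (comp_tright _)
  | |- computable (fun a => tcur _) => refine (comp_tcur _)
  | |- computable (fun a => Tape _ _ _) => refine (comp_tape _ _ _)
  | |- computable (fun a => match _ with MoveLeft => _ | Stay => _ | MoveRight => _ end) =>
      refine (comp_case_move _ _ _ _)
  | |- computable (fun a => finfun _) => refine (comp_ffun _); intro
  | |- computable (fun a => fun_of_fin _ _) => refine (comp_ffun_app _ _)
  end.

Ltac comp_user ::= first [comp_lib | comp_tm].

Definition run (M : TM) (s : nat) (p u : seq bool) : option (seq bool) :=
  let c := iter s (@tm_step M) (tm_init M p u) in
  if tm_halt c.1 then Some (str_of_tape (c.2 ord0)) else None.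

Lemma comp_tm_step (M : TM) :
  computable (fun c : tm_state M * {ffun 'I_(tm_work M).+2 -> tape} =>
    (tm_step c : tm_state M * {ffun 'I_(tm_work M).+2 -> tape})).
Proof.
pose tr (x : tm_state M * {ffun 'I_(tm_work M).+2 -> option bool}) := @tm_trans M x.1 x.2.
have htr : computable tr.
  apply: comp_finite => -[q f] [q' f'] [/enc_state_inj -> h].
  by rewrite (enc_ffun_inj enc_symbol_inj h).
have hh : computable (@tm_halt M) by apply: comp_finite; exact: enc_state_inj.
apply: (@comp_ext _ _ _ _ (fun c : tm_state M * {ffun 'I_(tm_work M).+2 -> tape} =>
   if tm_halt c.1 then c else
   ((tr (c.1, [ffun i => tcur (c.2 i)])).1,
    [ffun i => tape_move ((tr (c.1, [ffun i => tcur (c.2 i)])).2 i).2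
       (tape_write ((tr (c.1, [ffun i => tcur (c.2 i)])).2 i).1 (c.2 i))]))).
  by move=> [q T]; rewrite /tm_step /=; case: ifP => // _; rewrite /tr /=; case: tm_trans.
rewrite /tape_move /tape_write; clearbody tr; comp_tac.
refine (comp_o hh _); comp_tac.
Qed.

Lemma comp_str_of_tape A `{Enc A} (t : A -> tape) :
  computable t -> computable (fun a => str_of_tape (t a)).
Proof.
move=> ht; rewrite /str_of_tape.
apply: (@comp_ext _ _ _ _ (fun a => foldr (fun x s => if x is Some b then b :: s else [::])
    [::] (tcur (t a) :: tright (t a)))).
  by move=> a; elim: (_ :: _) => //= -[b|] s IH //=; rewrite IH.
comp_tac.
Qed.

Lemma comp_run (M : TM) A `{Enc A} (s : A -> nat) (p u : A -> seq bool) :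
  computable s -> computable p -> computable u ->
  computable (fun a => run M (s a) (p a) (u a)).
Proof.
move=> hs hp hu.
have hh : computable (@tm_halt M) by apply: comp_finite; exact: enc_state_inj.
have hst := comp_tm_step M.
have hi : computable (fun a => (tm_init M (p a) (u a)
    : tm_state M * {ffun 'I_(tm_work M).+2 -> tape})).
  apply: (comp_pair (comp_const _)); apply: comp_ffun => i.
  rewrite /tape_of_str /ohead.
  comp_tac.
have hc : computable (fun a => (iter (s a) (@tm_step M) (tm_init M (p a) (u a))
    : tm_state M * {ffun 'I_(tm_work M).+2 -> tape})).
  by apply: comp_iter => //; refine (comp_o hst _); comp_tac.
refine (comp_if _ _ _).
- exact: (comp_o hh (comp_fst hc)).
- by apply: comp_Some; apply: comp_str_of_tape; apply: comp_ffun_app; exact: comp_snd hc.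
- exact: comp_const.
Qed.

Lemma runP M p u x : computes M p u x <-> exists s, run M s p u = Some x.
Proof.
split=> [[k /= [h <-]]|[s]]; first by exists k; rewrite /run h.
by rewrite /run; case: ifP => // h [<-]; exists s.
Qed.

Lemma run_mono M p u x s s' : s <= s' -> run M s p u = Some x -> run M s' p u = Some x.
Proof.
move=> /subnK <-; elim: (s' - s) => // k IH /IH.
rewrite /run addSn iterS; set c := iter _ _ _; case: ifP => // h.
by rewrite [tm_step c]/tm_step h h.
Qed.

(** * Upper bounds on Kolmogorov complexity *)

(** The search for the first stage at which [f p u] is defined is a while program, hence a machine,
    and universality charges a constant that depends on [f] alone, neither on [u] nor on the running
    time. *)
Lemma KC_search (U : TM) (f : seq bool -> seq bool -> nat -> option (seq bool)) :
  universal U ->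
  computable (fun x : (seq bool * seq bool) * nat => f x.1.1 x.1.2 x.2) ->
  exists c, forall p u x s, f p u s = Some x ->
    (forall s', s' < s -> f p u s' = None) -> KC U x u <= size p + c.
Proof.
move=> hU hf.
have [ct ht] : computable (fun x : (seq bool * seq bool) * nat =>
    if f x.1.1 x.1.2 x.2 is Some _ then false else true) by comp_tac.
have [cn hn] : computable (fun x : (seq bool * seq bool) * nat => (x.1, x.2.+1)) by comp_tac.
have [co ho] : computable (fun x : (seq bool * seq bool) * nat =>
    if f x.1.1 x.1.2 x.2 is Some y then y else [::]) by comp_tac.
have [ci hi] : computable (fun x : seq bool * seq bool => (x, 0)) by comp_tac.
pose cc := CComp co (CComp (CWhile ct cn) ci).
have [c hc] := hU (TM_of (main_stmt cc)); exists c => p u x s hx hs.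
have [q hq Uq] := hc p.
apply: leq_trans hq; apply: (KCP x u hU).2; apply/Uq; apply: ev_computes.
apply: ev_comp; last by have := ho ((p, u), s); rewrite /= hx; exact.
apply: ev_comp; first exact: (hi (p, u)).
(* Induction on the number [k] of iterations left before the exit. *)
have H k : k <= s -> ev (CWhile ct cn) (enc ((p, u), s - k)) (enc ((p, u), s)).
  elim: k => [|k IH] hk.
    by rewrite subn0; apply: ev_while0; have := ht ((p, u), s); rewrite /= hx.
  apply: (ev_while1 (x := Leaf) (y := Leaf) (d1 := enc ((p, u), s - k))).
  - have := ht ((p, u), s - k.+1); rewrite /= hs //; lia.
  - have := hn ((p, u), s - k.+1); rewrite /=.
    by have -> : (s - k.+1).+1 = s - k by lia.
  - by apply: IH; lia.
by have := H s (leqnn s); rewrite subnn.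
Qed.

(** * Decoding numbers and lists *)

Definition dec_nat (s : seq bool) : nat :=
  foldr (fun b n => if b then (n + n).+2 else (n + n).+1) 0 s.

Lemma enc_natK : cancel enc_nat dec_nat.
Proof.
move=> n; rewrite /enc_nat; elim: n => //= n {2}<-; elim: (iter _ _ _) => //= -[] s IH //=.
by rewrite IH; lia.
Qed.

(** Bijective numeration wastes no string, so an index below 2^k needs at most [k] bits, with no
    additive loss. *)
Lemma pow2_size_enc_nat n : 2 ^ size (enc_nat n) <= n.+1.
Proof.
rewrite -{2}[n]enc_natK; elim: (enc_nat n) => //= b s IH.
by rewrite expnS; case: b; lia.
Qed.

Lemma size_enc_nat_lt n k : n < 2 ^ k -> size (enc_nat n) <= k.
Proof.
by move=> h; rewrite -(leq_exp2l (m := 2)) //; apply: leq_trans (pow2_size_enc_nat n) h.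
Qed.

Lemma comp_dec_nat A `{Enc A} (s : A -> seq bool) :
  computable s -> computable (fun a => dec_nat (s a)).
Proof. move=> hs; rewrite /dec_nat; comp_tac. Qed.

Lemma size_self_delim s : size (self_delim s) = (size s).*2.+1.
Proof. by elim: s => //= b s ->. Qed.

(** The parser is stationary once it meets the closing [false], so iterating it as often as the
    input is long is always enough. *)
Definition take_step (st : seq bool * seq bool) :=
  if st.2 is b :: r then
    if b then if r is c :: r' then (c :: st.1, r') else st else st
  else st.

Definition take_delim (s : seq bool) : seq bool * seq bool :=
  let st := iter (size s) take_step ([::], s) in (rev st.1, behead st.2).

Lemma take_delimP (a r : seq bool) : take_delim (self_delim a ++ r) = (a, r).
Proof.
rewrite /take_delim.
have H n acc : size a <= n ->
    iter n take_step (acc, self_delim a ++ r) = (rev a ++ acc, false :: r).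
  elim: a n acc => [|b a IH] [|n] acc //= h.
  - by rewrite iter_fix.
  - by rewrite -iterS iterSr /= IH // rev_cons -cats1 -catA.
by rewrite H ?cats0 ?revK // size_cat size_self_delim; lia.
Qed.

Definition list_step (st : seq (seq bool) * seq bool) :=
  if st.2 is _ :: _ then let t := take_delim st.2 in (t.1 :: st.1, t.2) else st.

Definition dec_list (s : seq bool) : seq (seq bool) :=
  rev (iter (size s) list_step ([::], s)).1.

Lemma enc_listK : cancel enc_list dec_list.
Proof.
move=> l; rewrite /dec_list.
have H n acc : size l <= n ->
    iter n list_step (acc, enc_list l) = (rev l ++ acc, [::]).
  elim: l n acc => [|a l IH] [|n] acc // h; first by rewrite iter_fix.
  have E : list_step (acc, self_delim a ++ enc_list l) = (a :: acc, enc_list l).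
    (* [list_step] rests on the empty string; a self-delimiting code is never empty, even that of
       the empty string. *)
    have [b [s e]] : exists b s, self_delim a ++ enc_list l = b :: s.
      by case: (a) => [|c a']; do 2!eexists.
    by rewrite /list_step /snd e -e take_delimP.
  by rewrite iterSr [enc_list _]/(self_delim a ++ enc_list l) E IH // rev_cons -cats1 -catA.
rewrite H /= ?cats0 ?revK //; elim: l {H} => //= a l IH.
by rewrite /enc_list /= size_cat size_self_delim -/(enc_list l); lia.
Qed.

Lemma comp_take_delim A `{Enc A} (s : A -> seq bool) :
  computable s -> computable (fun a => take_delim (s a)).
Proof. move=> hs; rewrite /take_delim /take_step; comp_tac. Qed.

Lemma comp_dec_list A `{Enc A} (s : A -> seq bool) :
  computable s -> computable (fun a => dec_list (s a)).
Proof.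
move=> hs; rewrite /dec_list /list_step; comp_tac; apply: comp_take_delim; comp_tac.
Qed.

Lemma comp_self_delim A `{Enc A} (s : A -> seq bool) :
  computable s -> computable (fun a => self_delim (s a)).
Proof.
move=> hs; apply: (@comp_ext _ _ _ _ (fun a =>
    foldr (fun b t => [:: true, b & t]) [:: false] (s a))).
  by move=> a; elim: (s a) => //= b t ->.
comp_tac.
Qed.

Lemma comp_enc_list A `{Enc A} (l : A -> seq (seq bool)) :
  computable l -> computable (fun a => enc_list (l a)).
Proof.
move=> hl; rewrite /enc_list; comp_tac; apply: comp_self_delim; comp_tac.
Qed.

Definition strs (k : nat) : seq (seq bool) :=
  iter k (fun L => [::] :: map (cons false) L ++ map (cons true) L) [:: [::]].

Lemma comp_strs A `{Enc A} (n : A -> nat) :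
  computable n -> computable (fun a => strs (n a)).
Proof. move=> hn; rewrite /strs; comp_tac. Qed.

Ltac comp_str :=
  match goal with
  | |- computable (fun a => dec_nat _) => refine (comp_dec_nat _)
  | |- computable (fun a => take_delim _) => refine (comp_take_delim _)
  | |- computable (fun a => dec_list _) => refine (comp_dec_list _)
  | |- computable (fun a => enc_list _) => refine (comp_enc_list _)
  | |- computable (fun a => strs _) => refine (comp_strs _)
  | |- computable (fun a => run _ _ _ _) => refine (comp_run _ _ _ _)
  end.

Ltac comp_user ::= first [comp_lib | comp_str].

Lemma mem_strs s k : (s \in strs k) = (size s <= k).
Proof.
elim: k s => [|k IH] s; first by rewrite inE; case: s.
rewrite inE mem_cat; case: s => [|b s] //=.
have E c : (b :: s \in map (cons c) (strs k)) = (b == c) && (size s <= k).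
  rewrite -IH; apply/mapP/andP => [[t h [-> ->]]|[/eqP -> h]]; last by exists s.
  by rewrite eqxx.
by rewrite -/(strs k) !E; case: b {E} => /=; rewrite ?orbF.
Qed.

Lemma size_strs k : size (strs k) <= 2 ^ k.+1.
Proof.
suff : (size (strs k)).+1 = 2 ^ k.+1 by move <-.
elim: k => //= k IH; rewrite -/(strs k) size_cat !size_map expnS -IH; lia.
Qed.

(** Stage [s] of the enumeration of all strings of complexity at most [k] given [u]. *)
Definition outs (U : TM) (k : nat) (u : seq bool) (s : nat) : seq (seq bool) :=
  pmap (fun p => run U s p u) (strs k).

Lemma comp_outs U A `{Enc A} (k s : A -> nat) (u : A -> seq bool) :
  computable k -> computable u -> computable s ->
  computable (fun a => outs U (k a) (u a) (s a)).
Proof. move=> hk hu hs; rewrite /outs; comp_tac. Qed.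

Lemma size_outs U k u s : size (outs U k u s) <= 2 ^ k.+1.
Proof.
by apply: leq_trans (size_strs k); rewrite size_pmap; exact: count_size.
Qed.

Lemma mem_outs U k u s x :
  reflect (exists2 p, size p <= k & run U s p u = Some x) (x \in outs U k u s).
Proof.
rewrite mem_pmap; apply: (iffP mapP) => [[p]|[p]].
  by rewrite mem_strs => hp e; exists p.
by rewrite -mem_strs => hp e; exists p.
Qed.

Lemma outs_mono U k u s s' : s <= s' -> {subset outs U k u s <= outs U k u s'}.
Proof.
move=> hs x /mem_outs[p hp e]; apply/mem_outs; exists p => //.
exact: run_mono e.
Qed.

Lemma outs_KC U x u : universal U -> exists s, x \in outs U (KC U x u) u s.
Proof.
move=> hU; have [[p hp /runP[s e]] _] := KCP x u hU.
by exists s; apply/mem_outs; exists p; rewrite ?hp.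
Qed.

Ltac comp_outs_tac :=
  match goal with
  | |- computable (fun a => outs _ _ _ _) => refine (comp_outs _ _ _ _)
  end.

Ltac comp_user ::= first [comp_lib | comp_str | comp_outs_tac].

(** Elements are listed in the order of their first appearance: later stages only append, so the
    index of an element is the same at all stages that contain it. *)
Definition enum_step (E : nat -> seq (seq bool)) (st : nat * seq (seq bool)) :=
  (st.1.+1, st.2 ++ [seq z <- undup (E st.1) | z \notin st.2]).

Definition enumeration (E : nat -> seq (seq bool)) (s : nat) :=
  (iter s (enum_step E) (0, [::])).2.

Lemma enumerationS E s : enumeration E s.+1 =
  enumeration E s ++ [seq z <- undup (E s) | z \notin enumeration E s].
Proof.
rewrite /enumeration iterS /=; congr (_ ++ [seq z <- undup (E _) | _]).
by elim: s => //= s ->.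
Qed.

Lemma enumeration_uniq E s : uniq (enumeration E s).
Proof.
elim: s => // s IH; rewrite enumerationS cat_uniq IH filter_uniq ?undup_uniq // andbT.
by apply/hasPn => z; rewrite mem_filter => /andP[].
Qed.

Lemma enumeration_sub E s : (forall s, {subset E s <= E s.+1}) ->
  {subset enumeration E s <= E s}.
Proof.
move=> mono; elim: s => // s IH z; rewrite enumerationS mem_cat.
by case/orP => [/IH/mono //|]; rewrite mem_filter mem_undup => /andP[_ /mono].
Qed.

Lemma enumeration_prefix E s s' : s <= s' ->
  exists l, enumeration E s' = enumeration E s ++ l.
Proof.
move=> /subnK <-; elim: (s' - s) => [|k [l IH]]; first by exists [::]; rewrite cats0.
by eexists; rewrite addSn enumerationS {1}IH -catA.
Qed.

(** The shift by 2 makes the logarithm at least 1, so that additive constants are absorbed into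
    multiples of it. *)
Definition loglen (n : nat) : nat := trunc_log 2 n.+2.

Lemma loglen_gt0 n : 0 < loglen n.
Proof. by rewrite trunc_log_gt0. Qed.

Lemma size_enc_nat_le n N : n <= N -> size (enc_nat n) <= loglen N.
Proof.
move=> h; apply: trunc_log_max => //.
by apply: leq_trans (pow2_size_enc_nat n) _; lia.
Qed.

(* A program for z consists of the parameters ns and of the index of z in the
   enumeration. *)
Lemma KC_enum (U : TM) (m : nat) (E : seq nat -> seq bool -> nat -> seq (seq bool)) :
  universal U ->
  computable (fun x : (seq nat * seq bool) * nat => E x.1.1 x.1.2 x.2) ->
  (forall ns u s, {subset E ns u s <= E ns u s.+1}) ->
  exists c, forall ns u k z s N, size ns <= m -> all (fun n => n <= N) ns ->
    z \in E ns u s -> (forall s', size (undup (E ns u s')) <= 2 ^ k) ->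
    KC U z u <= k + c * loglen N.
Proof.
move=> hU hE mono.
(* The index comes last and needs no delimiter, so it costs only its own length; only the parameters
   are self-delimited. The default [None] means that the listing is still too short. *)
pose f p u s := let d := take_delim p in
  nth None (map Some (enumeration (E (map dec_nat (dec_list d.1)) u) s)) (dec_nat d.2).
have hf : computable (fun x : (seq bool * seq bool) * nat => f x.1.1 x.1.2 x.2).
  rewrite /f /enumeration /enum_step; comp_tac.
have [c0 hc] := KC_search hU hf.
(* Inside the list a parameter takes at most [3 * loglen N] bits; delimiting the whole list doubles
   this, with one more bit for its end. *)
exists (6 * m + 1 + c0) => ns u k z s N hm hN hz hk.
pose L := enumeration (E ns u).
have subL s' : size (L s') <= 2 ^ k.
  apply: leq_trans (hk s'); apply: uniq_leq_size; first exact: enumeration_uniq.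
  by move=> x /(enumeration_sub (mono ns u)); rewrite mem_undup.
have hzL : z \in L s.+1.
  rewrite /L enumerationS mem_cat; case: (boolP (z \in enumeration _ s)) => //= hn.
  by rewrite mem_filter hn mem_undup.
pose i := index z (L s.+1).
have hi : i < size (L s.+1) by rewrite index_mem.
pose w := enc_list (map enc_nat ns).
pose p := self_delim w ++ enc_nat i.
have fE s' : f p u s' = nth None (map Some (L s')) i.
  by rewrite /f /p take_delimP /= enc_listK enc_natK mapK //; exact: enc_natK.
have fz s' : f p u s' = if i < size (L s') then Some z else None.
  rewrite fE; case: ltnP => h; last by rewrite nth_default // size_map.
  rewrite (nth_map [::]) //; congr Some.
  have -> : nth [::] (L s') i = nth [::] (L s.+1) i.
    case: (leqP s' s.+1) => hs.
      by have [l e] := enumeration_prefix (E ns u) hs; rewrite /L e nth_cat h.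
    by have [l e] := enumeration_prefix (E ns u) (ltnW hs); rewrite /L e nth_cat hi.
  exact: nth_index.
have hp : size p <= k + (6 * m + 1) * loglen N.
  rewrite /p size_cat size_self_delim.
  have h1 : size (enc_nat i) <= k.
    by apply: size_enc_nat_lt; apply: leq_trans hi (subL _).
  have h2 : size w <= size ns * (3 * loglen N).
    rewrite /w; elim: (ns) hN => //= n l IH /andP[hn /IH].
    rewrite /enc_list /= size_cat size_self_delim -/(enc_list _).
    by have := size_enc_nat_le hn; have := loglen_gt0 N; nia.
  have h3 : size ns * (3 * loglen N) <= m * (3 * loglen N) by rewrite leq_mul2r hm orbT.
  by have := loglen_gt0 N; nia.
have [s0 hs0 mins0] : exists2 s0, f p u s0 = Some z &
    forall s', s' < s0 -> f p u s' = None.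
  have ex : exists s', i < size (L s') by exists s.+1.
  exists (ex_minn ex); case: ex_minnP => s0 h mn; first by rewrite fz h.
  by move=> s' hs'; rewrite fz; case: ltnP => // /mn; rewrite leqNgt hs'.
have := hc p u z s0 hs0 mins0; have := loglen_gt0 N; nia.
Qed.

(** * Inequalities for Kolmogorov complexity *)

Lemma KC_le_size (U : TM) : universal U ->
  exists c, forall x u, KC U x u <= size x + c.
Proof.
move=> hU; have [|c hc] := KC_search (f := fun p _ _ => Some p) hU; first comp_tac.
by exists c => x u; apply: (hc x u x 0).
Qed.

(** The enumeration of outputs is mapped through [f], with the complexity of [x] as parameter. This
    costs a logarithm where composing machines would cost a constant, which is harmless at the
    precision wanted. *)
Lemma KC_map (U : TM) (f : seq bool -> seq bool -> seq bool) :
  universal U -> computable (fun x : seq bool * seq bool => f x.1 x.2) ->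
  exists c, forall x u N, KC U x u <= N ->
    KC U (f x u) u <= KC U x u + c * loglen N.
Proof.
move=> hU hf.
pose E (ns : seq nat) u s := [seq f x u | x <- outs U (head 0 ns) u s].
have [||c hc] := KC_enum (E := E) 1 hU; first by rewrite /E; comp_tac.
  move=> ns u s z /mapP[x hx ->]; apply: map_f; exact: outs_mono hx.
exists (c + 1) => x u N hN; have [s hs] := outs_KC x u hU.
have := hc [:: KC U x u] u (KC U x u).+1 (f x u) s N isT.
rewrite /= hN => /(_ isT (map_f _ hs)) h.
apply: leq_trans (h _) _; last by have := loglen_gt0 N; lia.
move=> s'; apply: leq_trans (size_undup _) _; rewrite size_map; exact: size_outs.
Qed.

Lemma size_flatten_le (A : Type) (ll : seq (seq A)) B :
  all (fun l => size l <= B) ll -> size (flatten ll) <= size ll * B.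
Proof.
elim: ll => //= l ll IH /andP[h /IH]; rewrite size_cat mulSn; lia.
Qed.

(** The easy half of the chain rule: given the two complexities [a] and [b] there are at most
    2^(a+1) candidates for [y], and for each at most 2^(b+1) candidates for [x]. *)
Lemma KC_pair_le (U : TM) : universal U ->
  exists c, forall x y u N, KC U y u <= N -> KC U x (enc_list [:: y; u]) <= N ->
    KC2 U x y u <= KC U y u + KC U x (enc_list [:: y; u]) + c * loglen N.
Proof.
move=> hU.
pose E (ns : seq nat) u s := flatten [seq [seq enc_list [:: x; y]
   | x <- outs U (nth 0 ns 1) (enc_list [:: y; u]) s] | y <- outs U (nth 0 ns 0) u s].
have [||c hc] := KC_enum (E := E) 2 hU; first by rewrite /E; comp_tac.
  move=> ns u s z /flatten_mapP[y hy /mapP[x hx ->]].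
  apply/flatten_mapP; exists y; first exact: outs_mono hy.
  by apply: map_f; exact: outs_mono hx.
exists (c + 2) => x y u N hy hx.
set a := KC U y u; set b := KC U x _.
have [s1 hs1] := outs_KC y u hU; have [s2 hs2] := outs_KC x (enc_list [:: y; u]) hU.
have := hc [:: a; b] u (a.+1 + b.+1) (enc_list [:: x; y]) (maxn s1 s2) N isT.
rewrite /= hx hy => /(_ isT) h.
apply: leq_trans (h _ _) _; last by have := loglen_gt0 N; lia.
  apply/flatten_mapP; exists y; first by apply: outs_mono hs1; lia.
  by apply: map_f; apply: outs_mono hs2; lia.
move=> s'; apply: leq_trans (size_undup _) _.
apply: leq_trans (size_flatten_le (B := 2 ^ b.+1) _) _.
  by apply/allP => l /mapP[y' _ ->]; rewrite size_map; exact: size_outs.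
by rewrite expnD leq_mul2r size_map size_outs orbT.
Qed.

(** * Double counting and symmetry of information *)

Lemma sum_count_exchange (S T : Type) (Y : seq S) (L : seq T) (P : S -> T -> bool) :
  \sum_(y <- Y) count (P y) L = \sum_(z <- L) count (P^~ z) Y.
Proof.
under eq_bigr do rewrite -sum1_count big_mkcond /=.
under [RHS]eq_bigr do rewrite -sum1_count big_mkcond /=.
exact: exchange_big.
Qed.

Lemma sum_seq_ge (T : eqType) (Y : seq T) (F : T -> nat) m :
  (forall y, y \in Y -> m <= F y) -> size Y * m <= \sum_(y <- Y) F y.
Proof.
elim: Y => [|y Y IH] h; first by rewrite big_nil.
rewrite big_cons /= mulSn leq_add ?h ?mem_head // IH // => z hz.
by apply: h; rewrite inE hz orbT.
Qed.

Lemma sum_seq_le (T : eqType) (Y : seq T) (F : T -> nat) m :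
  (forall y, y \in Y -> F y <= m) -> \sum_(y <- Y) F y <= size Y * m.
Proof.
elim: Y => [|y Y IH] h; first by rewrite big_nil.
rewrite big_cons /= mulSn leq_add ?h ?mem_head // IH // => z hz.
by apply: h; rewrite inE hz orbT.
Qed.

(** Here [f s] is the size of a set as known at stage [s]. Its limit cannot be computed, but [j] is
    cheap to specify, bounds the size at all stages, and is witnessed at the finite stage [s1]. *)
Lemma dyadic_bound (f : nat -> nat) (B s0 : nat) :
  0 < f s0 -> (forall s, f s <= 2 ^ B) ->
  exists j s1, [/\ j <= B, 2 ^ j <= f s1 & forall s, f s <= 2 ^ j.+1].
Proof.
move=> h0 hB; pose P j := `[< exists s, 2 ^ j <= f s >].
have exP : exists j, P j by exists 0; apply/asboolP; exists s0.
have ubP j : P j -> j <= B.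
  move=> /asboolP[s hs]; rewrite -(leq_exp2l (m := 2)) //; exact: leq_trans hs (hB s).
case: (ex_maxnP exP ubP) => j Pj mj; have /asboolP[s1 hs1] := Pj.
exists j, s1; split=> //; first exact: ubP.
move=> s; rewrite leqNgt; apply/negP => h.
have Pj1 : P j.+1 by apply/asboolP; exists s; exact: ltnW h.
by have := mj _ Pj1; rewrite ltnn.
Qed.

Definition dec_pair (z : seq bool) : option (seq bool * seq bool) :=
  if dec_list z is x :: l then if l is y :: _ then Some (x, y) else None else None.

Definition pair_outs U m u s := undup (pmap dec_pair (outs U m u s)).

Definition section U m u s (y : seq bool) :=
  [seq z.1 | z <- pair_outs U m u s & z.2 == y].

Lemma section_mono U m u s s' y : s <= s' ->
  {subset section U m u s y <= section U m u s' y}.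
Proof.
move=> h x /mapP[z]; rewrite mem_filter mem_undup mem_pmap => /andP[zy /mapP[w hw e]] ->.
apply: map_f; rewrite mem_filter zy mem_undup mem_pmap e; apply: map_f.
exact: outs_mono hw.
Qed.

Lemma section_uniq U m u s y : uniq (section U m u s y).
Proof.
rewrite map_inj_in_uniq ?filter_uniq ?undup_uniq // => -[x1 y1] [x2 y2].
by rewrite !mem_filter /= => /andP[/eqP -> _] /andP[/eqP -> _] ->.
Qed.

Lemma size_pair_outs U m u s : size (pair_outs U m u s) <= 2 ^ m.+1.
Proof.
apply: leq_trans (size_undup _) _; apply: leq_trans (size_outs U m u s).
by rewrite size_pmap; exact: count_size.
Qed.

(* The Kolmogorov-Levin argument: with 2^j the approximate number of x' such that
   C(x',y|u) <= C(x,y|u), x is specified by j bits given y, and y is one of at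
   most 2^(C(x,y|u)-j) strings with that many x'. *)
Lemma KC_pair_ge (U : TM) : universal U ->
  exists c, forall x y u N, KC2 U x y u < N ->
    KC U x (enc_list [:: y; u]) + KC U y u <= KC2 U x y u + c * loglen N.
Proof.
move=> hU.
(* The condition [v] codes the pair of [y] and [u]; the section itself is formed relative to [u]
   alone. *)
pose E1 (ns : seq nat) v s :=
  section U (head 0 ns) (nth [::] (dec_list v) 1) s (nth [::] (dec_list v) 0).
pose E2 (ns : seq nat) u s := [seq y <- undup [seq z.2 | z <- pair_outs U (nth 0 ns 0) u s]
   | 2 ^ nth 0 ns 1 <= size (section U (nth 0 ns 0) u s y)].
have [||c1 hc1] := KC_enum (E := E1) 1 hU.
  by rewrite /E1 /section /pair_outs /dec_pair; comp_tac.
  by move=> ns u s; exact: section_mono.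
have [||c2 hc2] := KC_enum (E := E2) 2 hU.
  by rewrite /E2 /section /pair_outs /dec_pair; comp_tac.
  move=> ns u s y; rewrite !mem_filter !mem_undup => /andP[h /mapP[z hz e]].
  apply/andP; split.
    apply: leq_trans h _; apply: uniq_leq_size (section_uniq _ _ _ _ _) _.
    exact (section_mono (leqnSn s)).
  rewrite e; apply: map_f; move: hz; rewrite !mem_undup !mem_pmap => /mapP[w hw ->].
  by apply: map_f; exact: outs_mono hw.
exists (c1 + c2 + 2) => x y u N; set m := KC2 U x y u => hm.
have [s0] : exists s0, x \in section U m u s0 y.
  have [s hs] := outs_KC (enc_list [:: x; y]) u hU; exists s.
  apply/mapP; exists (x, y) => //; rewrite mem_filter eqxx mem_undup mem_pmap.
  by apply/mapP; exists (enc_list [:: x; y]) => //; rewrite /dec_pair enc_listK.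
move=> hx.
have [||j [s1 [hj1 hj2 hj3]]] := @dyadic_bound (fun s => size (section U m u s y)) m.+1 s0.
- by move: hx; case: section.
- move=> s; rewrite size_map size_filter.
  exact: leq_trans (count_size _ _) (size_pair_outs U m u s).
have h1 : KC U x (enc_list [:: y; u]) <= j.+1 + c1 * loglen N.
  apply: (hc1 [:: m] _ _ _ s0); rewrite //= ?andbT ?(ltnW hm) //.
    by rewrite /E1 enc_listK.
  by move=> s; rewrite /E1 enc_listK; apply: leq_trans (size_undup _) (hj3 s).
have hy : y \in E2 [:: m; j] u s1.
  rewrite mem_filter hj2 mem_undup /=.
  have : 0 < size (section U m u s1 y) by apply: leq_trans hj2; rewrite expn_gt0.
  rewrite /section size_map; case E: (filter _ _) => [//|z l] _.
  have : z \in [seq z <- pair_outs U m u s1 | z.2 == y] by rewrite E mem_head.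
  by rewrite mem_filter => /andP[/eqP <-]; exact: map_f.
(* Sections over distinct [y] are disjoint parts of the at most 2^(m+1) pairs found, so few of them
   can be large. *)
have h2 s : size (E2 [:: m; j] u s) * 2 ^ j <= 2 ^ m.+1.
  apply: leq_trans (size_pair_outs U m u s).
  apply: (@leq_trans (\sum_(y' <- E2 [:: m; j] u s)
      count (fun z => z.2 == y') (pair_outs U m u s))).
    apply: sum_seq_ge => y'; rewrite mem_filter /= => /andP[+ _].
    by rewrite /section size_map size_filter.
  rewrite sum_count_exchange -[X in _ <= X]muln1; apply: sum_seq_le => z _.
  rewrite (eq_count (a2 := pred1 z.2)); last by move=> w; rewrite /= eq_sym.
  by rewrite count_uniq_mem ?leq_b1 // filter_uniq ?undup_uniq.
(* The parameter [j] may equal [m.+1]; the strict bound [m < N] keeps it at most [N]. *)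
have h3 : KC U y u <= m.+1 - j + c2 * loglen N.
  apply: (hc2 [:: m; j] _ _ _ s1) => //=; first by rewrite (ltnW hm); lia.
  move=> s; apply: leq_trans (size_undup _) _.
  rewrite -(leq_pmul2r (m := 2 ^ j)) ?expn_gt0 // -expnD subnK //.
have := loglen_gt0 N; lia.
Qed.

(* An incidence is a triple (t, (x, y)) such that the cell (x, y) lies in the
   rectangle named t. *)
Definition incidence : Type := (seq bool * (seq bool * seq bool))%type.

Definition rows_of U (J : seq incidence) a P s t :=
  undup [seq x <- outs U a P s | has (fun j : incidence => (j.1 == t) && (j.2.1 == x)) J].

Definition cols_of U (J : seq incidence) b P s t :=
  undup [seq y <- outs U b P s | has (fun j : incidence => (j.1 == t) && (j.2.2 == y)) J].

Definition incidences_at (J : seq incidence) (xy : seq bool * seq bool) :=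
  undup [seq j.1 | j <- J & j.2 == xy].

Lemma rows_of_mono U J a P s s' t : s <= s' ->
  {subset rows_of U J a P s t <= rows_of U J a P s' t}.
Proof.
move=> h x; rewrite !mem_undup !mem_filter => /andP[-> /=]; exact: outs_mono.
Qed.

Lemma cols_of_mono U J a P s s' t : s <= s' ->
  {subset cols_of U J a P s t <= cols_of U J a P s' t}.
Proof.
move=> h x; rewrite !mem_undup !mem_filter => /andP[-> /=]; exact: outs_mono.
Qed.

Lemma size_rows_of U J a P s t : size (rows_of U J a P s t) <= 2 ^ a.+1.
Proof.
apply: leq_trans (size_undup _) _; apply: leq_trans (size_outs U a P s).
by rewrite size_filter; exact: count_size.
Qed.

Lemma size_cols_of U J a P s t : size (cols_of U J a P s t) <= 2 ^ a.+1.
Proof.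
apply: leq_trans (size_undup _) _; apply: leq_trans (size_outs U a P s).
by rewrite size_filter; exact: count_size.
Qed.

(** The numbers of rows and columns grow with [s], while the thickness test is decided on the table
    [J] and does not involve [s]. So the family grows with [s]. *)
Definition wide_rects U (J : seq incidence) a b al be r P s :=
  [seq t <- undup [seq j.1 | j <- J] |
    (2 ^ al <= size (rows_of U J a P s t)) &&
    ((2 ^ be <= size (cols_of U J b P s t)) &&
     all (fun j : incidence => if j.1 == t then size (incidences_at J j.2) <= 2 ^ r else true) J)].

Definition rectangular (J : seq incidence) := forall t x y x' y',
  (t, (x, y)) \in J -> (t, (x', y')) \in J -> (t, (x, y')) \in J.

(* Each wide rectangle contains at least 2^(al + be) of the at most 2^(a + b + 2)
   pairs of simple strings, and each pair lies in at most 2^r of them. *)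
Lemma size_wide_rects U J a b al be r P s : rectangular J ->
  size (wide_rects U J a b al be r P s) * 2 ^ (al + be) <= 2 ^ (a.+1 + b.+1 + r).
Proof.
move=> rJ; set Y := wide_rects _ _ _ _ _ _ _ _ _.
pose A := undup (outs U a P s); pose B := undup (outs U b P s).
pose L := [seq (x, y) | x <- A, y <- B].
pose inc t xy := (t, xy) \in J.
apply: (@leq_trans (\sum_(t <- Y) count (inc t) L)).
  apply: sum_seq_ge => t; rewrite mem_filter => /andP[/andP[h1 /andP[h2 _]] _].
  rewrite expnD; apply: leq_trans (leq_mul h1 h2) _.
  rewrite -size_filter -(size_allpairs pair); apply: uniq_leq_size.
    by apply: allpairs_uniq; rewrite ?undup_uniq // => -[? ?] [? ?] _ _.
  move=> _ /allpairsP[[x y] [/= hx hy ->]].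
  move: hx hy; rewrite !mem_undup !mem_filter => /andP[/hasP[j1 j1J /andP[/eqP e1 /eqP e2]] hx].
  move=> /andP[/hasP[j2 j2J /andP[/eqP e3 /eqP e4]] hy].
  apply/andP; split; last by apply/allpairsP; exists (x, y); rewrite !mem_undup.
  (* The row is known from one cell of [t] and the column from another; rectangularity puts their
     crossing into [t]. *)
  apply: (rJ _ _ j1.2.2 j2.2.1 _); rewrite -?e2 -?e4.
    by rewrite -e1; case: (j1) j1J => ? [].
  by rewrite -e3; case: (j2) j2J => ? [].
rewrite sum_count_exchange.
apply: (@leq_trans (size L * 2 ^ r)); last first.
  rewrite expnD leq_mul2r; apply/orP; right; rewrite size_allpairs expnD leq_mul //.
    exact: leq_trans (size_undup _) (size_outs U a P s).
  exact: leq_trans (size_undup _) (size_outs U b P s).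
apply: sum_seq_le => xy _; rewrite -size_filter.
(* A pair in no wide rectangle contributes 0. Otherwise the thickness test of a single wide
   rectangle through the pair bounds the number of all rectangles through it. *)
case E: [seq t <- Y | inc t xy] => [//|t l]; rewrite -E.
have : t \in [seq t <- Y | inc t xy] by rewrite E mem_head.
rewrite !mem_filter => /andP[tJ /andP[/andP[_ /andP[_ /allP hall]] _]].
have := hall _ tJ; rewrite /= eqxx; apply: leq_trans.
apply: uniq_leq_size; first by rewrite !filter_uniq ?undup_uniq.
move=> t' ; rewrite mem_filter => /andP[t'J _]; rewrite mem_undup.
by apply/mapP; exists (t', xy) => //; rewrite mem_filter eqxx.
Qed.

(** Thickness is assumed only on the cells of [t], which is why [wide_rects] tests each rectangle
    separately instead of relying on a bound for the whole table. *)
Lemma KC_rectangle (U : TM) (J : seq bool -> seq incidence) : universal U ->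
  computable J ->
  exists c, forall P t x y r N, rectangular (J P) -> (t, (x, y)) \in J P ->
    (forall xy, (t, xy) \in J P -> size (incidences_at (J P) xy) <= 2 ^ r) ->
    KC U x P < N -> KC U y P < N -> r <= N ->
    KC U t P + KC U x (enc_list [:: t; P]) + KC U y (enc_list [:: t; P])
      <= KC U x P + KC U y P + r + c * loglen N.
Proof.
move=> hU hJ.
pose Ex (ns : seq nat) v s := rows_of U (J (nth [::] (dec_list v) 1)) (nth 0 ns 0)
  (nth [::] (dec_list v) 1) s (nth [::] (dec_list v) 0).
pose Ey (ns : seq nat) v s := cols_of U (J (nth [::] (dec_list v) 1)) (nth 0 ns 0)
  (nth [::] (dec_list v) 1) s (nth [::] (dec_list v) 0).
pose Et (ns : seq nat) P s := wide_rects U (J P) (nth 0 ns 0) (nth 0 ns 1) (nth 0 ns 2)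
  (nth 0 ns 3) (nth 0 ns 4) P s.
have [||c1 hc1] := KC_enum (E := Ex) 1 hU.
- by rewrite /Ex /rows_of; comp_tac.
- by move=> ns v s; exact: rows_of_mono.
have [||c2 hc2] := KC_enum (E := Ey) 1 hU.
- by rewrite /Ey /cols_of; comp_tac.
- by move=> ns v s; exact: cols_of_mono.
have [||c3 hc3] := KC_enum (E := Et) 5 hU.
- by rewrite /Et /wide_rects /incidences_at /rows_of /cols_of; comp_tac.
- move=> ns P s t; rewrite !mem_filter => /andP[/andP[h1 /andP[h2 ->]] ->].
  rewrite !andbT; apply/andP; split.
    by apply: leq_trans h1 _; apply: uniq_leq_size; [exact: undup_uniq|exact: rows_of_mono].
  by apply: leq_trans h2 _; apply: uniq_leq_size; [exact: undup_uniq|exact: cols_of_mono].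
exists (c1 + c2 + c3 + 4) => P t x y r N rJ txy hthick.
set a := KC U x P; set b := KC U y P => ha hb hr.
have [s1 hs1] := outs_KC x P hU; have [s2 hs2] := outs_KC y P hU.
have hx : x \in rows_of U (J P) a P s1 t.
  by rewrite mem_undup mem_filter hs1 andbT; apply/hasP; exists (t, (x, y)); rewrite //= !eqxx.
have hy : y \in cols_of U (J P) b P s2 t.
  by rewrite mem_undup mem_filter hs2 andbT; apply/hasP; exists (t, (x, y)); rewrite //= !eqxx.
have [||al [s3 [al1 al2 al3]]] :=
  @dyadic_bound (fun s => size (rows_of U (J P) a P s t)) a.+1 s1.
- by move: hx; case: rows_of.
- by move=> s; exact: size_rows_of.
have [||be [s4 [be1 be2 be3]]] :=
  @dyadic_bound (fun s => size (cols_of U (J P) b P s t)) b.+1 s2.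
- by move: hy; case: cols_of.
- by move=> s; exact: size_cols_of.
have h1 : KC U x (enc_list [:: t; P]) <= al.+1 + c1 * loglen N.
  apply: (hc1 [:: a] _ _ _ s1); rewrite //= ?andbT ?(ltnW ha) //.
    by rewrite /Ex enc_listK.
  by move=> s; rewrite /Ex enc_listK; apply: leq_trans (size_undup _) (al3 s).
have h2 : KC U y (enc_list [:: t; P]) <= be.+1 + c2 * loglen N.
  apply: (hc2 [:: b] _ _ _ s2); rewrite //= ?andbT ?(ltnW hb) //.
    by rewrite /Ey enc_listK.
  by move=> s; rewrite /Ey enc_listK; apply: leq_trans (size_undup _) (be3 s).
(* Both counts have reached their powers of two at the later of the two stages. *)
pose s0 := maxn s3 s4; pose ns := [:: a; b; al; be; r].
have ht : t \in Et ns P s0.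
  rewrite mem_filter mem_undup (map_f fst txy) andbT; apply/and3P; split.
  - apply: leq_trans al2 _; apply: uniq_leq_size; first exact: undup_uniq.
    by apply: rows_of_mono; rewrite leq_maxl.
  - apply: leq_trans be2 _; apply: uniq_leq_size; first exact: undup_uniq.
    by apply: cols_of_mono; rewrite leq_maxr.
  - by apply/allP => -[t' xy] h /=; case: eqP => // e; apply: hthick; rewrite -e.
have cnt s : size (Et ns P s) * 2 ^ (al + be) <= 2 ^ (a.+1 + b.+1 + r).
  exact: size_wide_rects.
(* The family is nonempty at stage [s0], so the counting bound compares the exponents; this makes
   the truncated subtraction below exact. *)
have hle : al + be <= a.+1 + b.+1 + r.
  rewrite -(leq_exp2l (m := 2)) //; apply: leq_trans (cnt s0).
  by rewrite leq_pmull //; move: ht; case: (Et _ _ _).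
have h3 : KC U t P <= (a.+1 + b.+1 + r - (al + be)) + c3 * loglen N.
  apply: (hc3 ns _ _ _ s0) => //=.
    by rewrite (ltnW ha) (ltnW hb) hr /= andbT; lia.
  move=> s; apply: leq_trans (size_undup _) _.
  by rewrite -(leq_pmul2r (m := 2 ^ (al + be))) ?expn_gt0 // -expnD subnK //.
(* Adding the three bounds cancels [al] and [be]; the four units lost to roundings go into
   [loglen N]. *)
have := loglen_gt0 N; lia.
Qed.

(** * Decoding protocols *)

(** The recursion needs the tail itself as well as its successor, so the fold carries both. *)
Lemma comp_str_succ A `{Enc A} (s : A -> seq bool) :
  computable s -> computable (fun a => str_succ (s a)).
Proof.
move=> hs; apply: (@comp_ext _ _ _ _ (fun a =>
    (foldr (fun b (z : seq bool * seq bool) =>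
              (b :: z.1, if b then false :: z.2 else true :: z.1))
           ([::], [:: false]) (s a)).2)).
  move=> a; set F := foldr _ _.
  suff -> : F (s a) = (s a, str_succ (s a)) by [].
  by elim: (s a) => //= b t ->; case: b.
comp_tac.
Qed.

Lemma comp_enc_nat A `{Enc A} (n : A -> nat) :
  computable n -> computable (fun a => enc_nat (n a)).
Proof. by move=> hn; rewrite /enc_nat; comp_tac; apply: comp_str_succ; comp_tac. Qed.

Lemma comp_iota0 A `{Enc A} (n : A -> nat) :
  computable n -> computable (fun a => iota 0 (n a)).
Proof.
move=> hn; apply: (@comp_ext _ _ _ _ (fun a => iter (n a) (fun l => l ++ [:: size l]) [::])).
  by move=> a; elim: (n a) => // k IH; rewrite iterS IH -addn1 iotaD size_iota.
comp_tac.
Qed.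

Definition word_strs (n : nat) : seq (seq bool) :=
  iter n (fun L => map (cons false) L ++ map (cons true) L) [:: [::]].

Lemma comp_word_strs A `{Enc A} (n : A -> nat) :
  computable n -> computable (fun a => word_strs (n a)).
Proof. move=> hn; rewrite /word_strs; comp_tac. Qed.

Lemma word_strsE n : word_strs n = [seq tval w | w <- words n].
Proof.
elim: n => //= n IH; rewrite -/(word_strs n) IH cats0 map_cat -!map_comp.
by congr (_ ++ _); apply: eq_map.
Qed.

Lemma mem_words n (w : cube n) : w \in words n.
Proof.
elim: n w => [|n IH] w; first by rewrite tuple0 inE.
case/tupleP: w => b w; apply/allpairsP; exists (b, w); split=> //.
by case: b.
Qed.

Definition cells (p : seq (seq bool)) : seq (seq bool * seq bool) :=
  [seq (x, y) | x <- word_strs (dec_nat (nth [::] p 0)),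
                y <- word_strs (dec_nat (nth [::] p 1))].

Definition table_entry (P x y : seq bool) : seq bool :=
  let p := dec_list P in
  nth [::] (dec_list (nth [::] p 3)) (index (x, y) (cells p)).

(** Defined on all strings, as a computable function must be; only on codes of protocols does it
    have its intended meaning. *)
Definition incidences (P : seq bool) : seq incidence :=
  let p := dec_list P in
  let rs := dec_list (nth [::] p 2) in
  [seq (enc_nat i, xy) | i <- iota 0 (size rs),
     xy <- [seq xy <- cells p | nth false (nth [::] rs i) (index xy (cells p))]].

Ltac comp_prot :=
  match goal with
  | |- computable (fun a => enc_nat _) => refine (comp_enc_nat _)
  | |- computable (fun a => iota 0 _) => refine (comp_iota0 _)
  | |- computable (fun a => word_strs _) => refine (comp_word_strs _)
  end.

Ltac comp_user ::= first [comp_lib | comp_str | comp_prot].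

Lemma comp_incidences : computable incidences.
Proof. rewrite /incidences /cells; comp_tac. Qed.

Lemma comp_table_entry A `{Enc A} (P x y : A -> seq bool) :
  computable P -> computable x -> computable y ->
  computable (fun a => table_entry (P a) (x a) (y a)).
Proof. move=> hP hx hy; rewrite /table_entry /cells; comp_tac. Qed.

Definition cell_str n1 n2 (xy : cube n1 * cube n2) : seq bool * seq bool :=
  (tval xy.1, tval xy.2).

Lemma cell_str_inj n1 n2 : injective (@cell_str n1 n2).
Proof. by move=> [x y] [x' y'] [/val_inj -> /val_inj ->]. Qed.

Definition word_pairs n1 n2 : seq (cube n1 * cube n2) :=
  [seq (x, y) | x <- words n1, y <- words n2].

Lemma mem_word_pairs n1 n2 (xy : cube n1 * cube n2) : xy \in word_pairs n1 n2.
Proof. by apply/allpairsP; exists xy; rewrite !mem_words; case: xy. Qed.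

Lemma map_word_pairs n1 n2 (T : Type) (f : cube n1 -> cube n2 -> T) :
  [seq f x y | x <- words n1, y <- words n2] =
  [seq f xy.1 xy.2 | xy <- word_pairs n1 n2].
Proof. by rewrite /word_pairs map_allpairs. Qed.

Lemma cellsE n1 n2 (Pi : protocol n1 n2) :
  cells (dec_list (enc_protocol Pi)) = [seq cell_str xy | xy <- word_pairs n1 n2].
Proof.
rewrite /cells /enc_protocol enc_listK /= !enc_natK !word_strsE.
by rewrite allpairs_mapl allpairs_mapr map_word_pairs.
Qed.

Lemma index_cells n1 n2 (Pi : protocol n1 n2) (xy : cube n1 * cube n2) :
  index (cell_str xy) (cells (dec_list (enc_protocol Pi))) = index xy (word_pairs n1 n2).
Proof. by rewrite cellsE index_map //; exact: cell_str_inj. Qed.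

Lemma table_entryE n1 n2 (Pi : protocol n1 n2) (x : cube n1) (y : cube n2) :
  table_entry (enc_protocol Pi) x y = transcript Pi x y.
Proof.
rewrite /table_entry -[(_, _)]/(cell_str (x, y)) index_cells /enc_protocol enc_listK /=.
rewrite enc_listK map_word_pairs (nth_map (x, y)) ?index_mem ?mem_word_pairs //.
by rewrite nth_index ?mem_word_pairs.
Qed.

Lemma mem_incidences n1 n2 (Pi : protocol n1 n2) (j : incidence) :
  j \in incidences (enc_protocol Pi) <->
  exists A xy, [/\ A \in rects Pi, xy \in A & j = (enc_nat (index A (rects Pi)), cell_str xy)].
Proof.
have bitE A xy : A \in rects Pi ->
    nth false (nth [::] [seq enc_set A | A <- rects Pi] (index A (rects Pi)))
      (index (cell_str xy) (cells (dec_list (enc_protocol Pi)))) = (xy \in A).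
  move=> hA; rewrite (nth_map A) ?index_mem // nth_index // index_cells.
  rewrite /enc_set map_word_pairs (nth_map xy) ?index_mem ?mem_word_pairs //.
  by rewrite nth_index ?mem_word_pairs //; case: (xy).
have rsE : dec_list (nth [::] (dec_list (enc_protocol Pi)) 2) = [seq enc_set A | A <- rects Pi].
  by rewrite /enc_protocol enc_listK /= enc_listK.
split=> [/allpairsPdep[i [z []]]|[A [xy [hA hxy ->]]]].
  rewrite rsE size_map mem_iota add0n /= => hi; rewrite mem_filter => /andP[hb].
  rewrite cellsE => /mapP[xy _ ez] ->.
  have hA : nth set0 (rects Pi) i \in rects Pi by rewrite mem_nth.
  have hI : index (nth set0 (rects Pi) i) (rects Pi) = i by rewrite index_uniq // rects_uniq.
  exists (nth set0 (rects Pi) i), xy; split=> //; last by rewrite hI ez.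
  by rewrite -bitE // hI -ez.
apply/allpairsPdep; exists (index A (rects Pi)), (cell_str xy); split=> //.
  by rewrite rsE size_map mem_iota add0n /= index_mem.
rewrite mem_filter rsE bitE // hxy cellsE; apply: map_f; exact: mem_word_pairs.
Qed.

Lemma incidences_rectangular n1 n2 (Pi : protocol n1 n2) :
  rectangular (incidences (enc_protocol Pi)).
Proof.
move=> t x y x' y' /mem_incidences[A [[X Y] [hA hXY [et ex ey]]]].
move=> /mem_incidences[A' [[X' Y'] [hA' hXY' [et' ex' ey']]]].
apply/mem_incidences; exists A, (X, Y'); split=> //; last by rewrite et ex ey'.
(* A rectangle is determined by its name, since its index is. *)
have eA : A = A'.
  apply: (index_inj A hA hA'); apply: (can_inj enc_natK); by rewrite -et -et'.
have [S [T eST]] := rects_rectangle hA; move: hXY hXY'.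
by rewrite -eA eST !in_setX => /andP[-> _] /andP[_ ->].
Qed.

(** The distinct names found at a cell are names of rectangles containing it, and the cell lies in
    the chosen rectangle, over which the thickness is a maximum. *)
Lemma incidences_thickness n1 n2 (Pi : protocol n1 n2) (x : cube n1) (y : cube n2) ab :
  (transcript Pi x y, ab) \in incidences (enc_protocol Pi) ->
  size (incidences_at (incidences (enc_protocol Pi)) ab) <= thickness Pi (chosen Pi (x, y)).
Proof.
move=> /mem_incidences[A [xy [hA hxy [et eab]]]].
have <- : A = chosen Pi (x, y).
  by apply: (index_inj A hA (chosen_rects _ _)); apply: (can_inj enc_natK).
apply: (@leq_trans (cell_thickness Pi xy)); last exact: leq_bigmax_cond.
rewrite /cell_thickness -size_filter.
rewrite -(size_map (fun B => enc_nat (index B (rects Pi)))).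
apply: uniq_leq_size; first exact: undup_uniq.
move=> t; rewrite mem_undup => /mapP[[t' ab']]; rewrite mem_filter /= => /andP[/eqP -> h] ->.
have [B [xy' [hB hxy' [-> e]]]] := (mem_incidences _ _).1 h.
apply: map_f; rewrite mem_filter hB andbT; move: e; rewrite eab => /cell_str_inj ->.
exact: hxy'.
Qed.

Lemma transcript_incidence n1 n2 (Pi : protocol n1 n2) (x : cube n1) (y : cube n2) :
  (transcript Pi x y, (tval x, tval y)) \in incidences (enc_protocol Pi).
Proof.
apply/mem_incidences; exists (chosen Pi (x, y)), (x, y).
by split=> //; [exact: chosen_rects|exact: chosen_mem].
Qed.

(** * Information cost *)

(** Permuting, regrouping, projecting or extending a tuple by a computable rule costs a
    logarithm. *)
Lemma KC_relist (U : TM) (h : seq (seq bool) -> seq bool -> seq (seq bool)) :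
  universal U ->
  computable (fun x : seq (seq bool) * seq bool => h x.1 x.2) ->
  exists c, forall l u N, KC U (enc_list l) u <= N ->
    KC U (enc_list (h l u)) u <= KC U (enc_list l) u + c * loglen N.
Proof.
move=> hU hh.
have [|c hc] := KC_map (f := fun z u => enc_list (h (dec_list z) u)) hU; first comp_tac.
by exists c => l u N /hc; rewrite enc_listK.
Qed.

(** Brings error terms measured by a bound linear in [n] back to the logarithm of [n]. *)
Lemma loglen_mul C : exists c, forall n, loglen (C * n.+1) <= c * loglen n.
Proof.
exists (C + 3) => n.
have h1 := trunc_logP (p := 2) (n := (C * n.+1).+2) isT isT.
have h2 := trunc_log_ltn (p := 2) n.+2 isT.
rewrite -/(loglen _) in h1 h2.
have h3 : C + 2 <= 2 ^ (C + 2) by apply: ltnW; exact: ltn_expl.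
have : 2 ^ loglen (C * n.+1) < 2 ^ (C + 2 + (loglen n).+1).
  rewrite expnD; apply: leq_ltn_trans h1 _.
  apply: (@leq_ltn_trans ((C + 2) * n.+2)); first nia.
  apply: (@leq_ltn_trans (2 ^ (C + 2) * n.+2)); first by rewrite leq_mul2r h3 orbT.
  by rewrite ltn_pmul2l ?expn_gt0.
rewrite ltn_exp2l //; have := loglen_gt0 n; nia.
Qed.

Lemma size_enc_list l : size (enc_list l) = \sum_(s <- l) (size s).*2.+1.
Proof.
elim: l => [|s l IH]; first by rewrite big_nil.
by rewrite big_cons -IH /enc_list /= size_cat size_self_delim.
Qed.

(** An integer form of both claims: the logarithm of the thickness is replaced by an arbitrary
    exponent [r] whose power of two bounds the thickness. *)
Lemma information_cost_bounds (U : TM) : universal U ->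
  exists c, forall (n1 n2 : nat) (Pi : protocol n1 n2) (x : cube n1) (y : cube n2),
    let t := transcript Pi x y in
    let P := enc_protocol Pi in
    let e := c * loglen (max_length Pi x y) in
    (`|IC U Pi x y - ((KC U t P)%:Z - I3 U x y t P)| <= e%:Z /\
     forall r, (thickness Pi (chosen Pi (x, y)) <= 2 ^ r)%N ->
       (IC U Pi x y <= (KC U t P)%:Z + r%:Z + e%:Z))%R.
Proof.
move=> hU.
have [c0 hc0] := KC_le_size hU.
have [c1 hle] := KC_pair_le hU.
have [c2 hge] := KC_pair_ge hU.
have [|c3 hswap] := KC_relist (h := fun l _ => [:: nth [::] l 1; nth [::] l 0]) hU.
  comp_tac.
have [|c4 hm4] := KC_relist (h := fun l _ =>
  let m := dec_list (nth [::] l 0) in [:: nth [::] m 0; nth [::] l 1; nth [::] m 1]) hU.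
  comp_tac.
have [|c5 hm5] := KC_relist (h := fun l _ =>
  [:: enc_list [:: nth [::] l 0; nth [::] l 2]; nth [::] l 1]) hU.
  comp_tac.
have [|c6 hm6] := KC_relist (h := fun l _ =>
  let m := dec_list (nth [::] l 0) in [:: nth [::] l 1; nth [::] m 0; nth [::] m 1]) hU.
  comp_tac.
have [|c7 hm7] := KC_relist (h := fun l _ =>
  [:: enc_list [:: nth [::] l 1; nth [::] l 2]; nth [::] l 0]) hU.
  comp_tac.
have [|c8 hm8] := KC_relist (h := fun l P =>
  [:: nth [::] l 0; nth [::] l 1; table_entry P (nth [::] l 0) (nth [::] l 1)]) hU.
  by comp_tac; apply: comp_table_entry; comp_tac.
have [|c9 hm9] := KC_relist (h := fun l _ => [:: nth [::] l 0; nth [::] l 1]) hU.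
  comp_tac.
have [c10 hrect] := KC_rectangle hU comp_incidences.
have [c11 hlog] := loglen_mul (2 * (c0 + 20)).
pose cs := c1 + c2 + c3 + c4 + c5 + c6 + c7 + c8 + c9 + c10.
exists (20 * cs * c11) => n1 n2 Pi x y t P e.
set n := max_length Pi x y in e *.
(* [K] exceeds the complexity of every string of length at most [16 * n.+1], which covers the nested
   tuples of [x], [y], [t] used below. The factor 2 in [N] serves the case of a large [r]. *)
pose N := 2 * (c0 + 20) * n.+1.
pose K := (c0 + 20) * n.+1.
have hN : N = 2 * K by rewrite /N mulnA.
have sx : size x <= n by rewrite /n /max_length; lia.
have sy : size y <= n by rewrite /n /max_length; lia.
have st : size t <= n by rewrite /n /max_length -/t; lia.
have KCb z u : size z <= 16 * n.+1 -> KC U z u < K.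
  by move=> hz; apply: leq_ltn_trans (hc0 z u) _; rewrite /K; nia.
have szE : (forall a b : seq bool, size (enc_list [:: a; b]) = (size a).*2 + (size b).*2 + 2)
    /\ (forall a b c : seq bool,
      size (enc_list [:: a; b; c]) = (size a).*2 + (size b).*2 + (size c).*2 + 3).
  by split=> *; rewrite size_enc_list !big_cons big_nil; lia.
have [sz2 sz3] := szE.
pose D := cs * loglen N.
have le_D c : c <= cs -> c * loglen N <= D by move=> h; rewrite leq_mul2r h orbT.
have small z u : size z <= 16 * n.+1 -> KC U z u < N by move=> /KCb h; have := h u; lia.
have s2 a b : size a <= 3 * n.+1 -> size b <= 3 * n.+1 -> size (enc_list [:: a; b]) <= 16 * n.+1.
  by rewrite sz2; lia.
(* Both halves of the chain rule relative to [P]; the first string may itself be a pair. *)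
have chain a b : size a <= 4 * n.+1 -> size b <= n ->
    KC U (enc_list [:: a; b]) P <= KC U b P + KC U a (enc_list [:: b; P]) + D /\
    KC U a (enc_list [:: b; P]) + KC U b P <= KC U (enc_list [:: a; b]) P + D.
  move=> ha hb; split.
    apply: leq_trans (hle a b P N _ _) _; try by apply: ltnW; apply: small; lia.
    by rewrite leq_add2l le_D // /cs; lia.
  apply: leq_trans (hge a b P N _) _; first by apply: small; rewrite sz2; lia.
  by rewrite leq_add2l le_D // /cs; lia.
have relist c h : (forall l u N, KC U (enc_list l) u <= N ->
    KC U (enc_list (h l u)) u <= KC U (enc_list l) u + c * loglen N) -> c <= cs ->
    forall l, size (enc_list l) <= 16 * n.+1 ->
    KC U (enc_list (h l P)) P <= KC U (enc_list l) P + D.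
  move=> hh hc l hl; apply: leq_trans (hh l P N _) _; first exact/ltnW/small.
  by rewrite leq_add2l le_D.
have sxt : size (enc_list [:: tval x; t]) <= 4 * n.+1 by rewrite sz2; lia.
have syt : size (enc_list [:: tval y; t]) <= 4 * n.+1 by rewrite sz2; lia.
have sxyt : size (enc_list [:: tval x; tval y; t]) <= 16 * n.+1 by rewrite sz3; lia.
have swap a b : size a <= 3 * n.+1 -> size b <= 3 * n.+1 ->
    KC U (enc_list [:: b; a]) P <= KC U (enc_list [:: a; b]) P + D.
  by move=> ha hb; apply: (relist _ _ hswap _ [:: a; b]); [rewrite /cs; lia|exact: s2].
have [x3 y3 t3] : [/\ size x <= 3 * n.+1, size y <= 3 * n.+1 & size t <= 3 * n.+1].
  by split; lia.
have [Cxy1 Cxy2] := chain (tval x) (tval y) ltac:(lia) sy.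
have [Cyx1 Cyx2] := chain (tval y) (tval x) ltac:(lia) sx.
have [Cty1 Cty2] := chain t (tval y) ltac:(lia) sy.
have [Ctx1 Ctx2] := chain t (tval x) ltac:(lia) sx.
have [Cxt1 _] := chain (tval x) t ltac:(lia) st.
have [Cyt1 _] := chain (tval y) t ltac:(lia) st.
have [Cxty1 Cxty2] := chain (enc_list [:: tval x; t]) (tval y) sxt sy.
have [Cytx1 Cytx2] := chain (enc_list [:: tval y; t]) (tval x) syt sx.
have Sxy := swap (tval x) (tval y) x3 y3; have Syx := swap (tval y) (tval x) y3 x3.
have Sty := swap t (tval y) t3 y3; have Syt := swap (tval y) t y3 t3.
have Stx := swap t (tval x) t3 x3; have Sxt := swap (tval x) t x3 t3.
(* The chain rule yields nested pairs; [M4] to [M7] exchange them with the flat triple in both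
   directions. [M8] and [M9] then compare the triple with the pair of inputs. *)
have M4 := relist _ _ hm4 ltac:(rewrite /cs; lia)
  [:: enc_list [:: tval x; t]; tval y] ltac:(rewrite sz2; lia).
have M5 := relist _ _ hm5 ltac:(rewrite /cs; lia) [:: tval x; tval y; t] sxyt.
have M6 := relist _ _ hm6 ltac:(rewrite /cs; lia)
  [:: enc_list [:: tval y; t]; tval x] ltac:(rewrite sz2; lia).
have M7 := relist _ _ hm7 ltac:(rewrite /cs; lia) [:: tval x; tval y; t] sxyt.
have M8 := relist _ _ hm8 ltac:(rewrite /cs; lia) [:: tval x; tval y] (s2 _ _ x3 y3).
have M9 := relist _ _ hm9 ltac:(rewrite /cs; lia) [:: tval x; tval y; t] sxyt.
rewrite /= ?enc_listK /= in M4 M5 M6 M7 M8 M9.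
rewrite /P table_entryE -/t -/P in M8.
(* Each inequality above loses at most [D]; the factor 20 leaves room for all those that the linear
   arguments below add up. *)
have eD : 20 * D <= e.
  rewrite /e /D -!mulnA leq_mul2l /= leq_mul2l; apply/orP; right; exact: hlog.
rewrite /IC /I3 /I2 /KC2 /KC3 -/t -/P; unfold str in *; split; first by lia.
move=> r hr.
have bxt := KCb (enc_list [:: tval x; t]) P ltac:(lia).
have byt := KCb (enc_list [:: tval y; t]) P ltac:(lia).
(* For [r] above [N] the bound is trivial: up to the error, the information cost is at most the sum
   of the complexities of the pairs with [t], which is below [2 * K = N]. *)
have [hrN|hrN] := leqP r N; last by lia.
have R : KC U t P + KC U x (enc_list [:: t; P]) + KC U y (enc_list [:: t; P])
      <= KC U x P + KC U y P + r + D.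
  apply: leq_trans (hrect P t x y r N _ _ _ _ _ _) _ => //.
  - exact: incidences_rectangular.
  - exact: transcript_incidence.
  - by move=> ab hab; apply: leq_trans (incidences_thickness hab) hr.
  - by apply: small; lia.
  - by apply: small; lia.
  - by rewrite leq_add2l le_D // /cs; lia.
lia.
Qed.

(** * Passage to real logarithms *)

Local Open Scope ring_scope.

Lemma ln2_gt0 (R : realType) : 0 < ln 2 :> R.
Proof. by rewrite ln_gt0 // ltr1n. Qed.

Lemma log2_ge (R : realType) (k m : nat) :
  (2 ^ k <= m)%N -> k%:R <= log2 (m%:R : R).
Proof.
move=> h; rewrite /log2 ler_pdivlMr ?ln2_gt0 // mulr_natl -lnXn ?ltr0n //.
rewrite ler_ln ?posrE -?natrX ?ltr0n ?ler_nat ?expn_gt0 //.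
by apply: leq_trans h; rewrite expn_gt0.
Qed.

Lemma log2_ge0 (R : realType) (m : nat) : 0 <= log2 (m%:R : R).
Proof.
case: m => [|m]; first by rewrite /log2 ln0 // mul0r.
exact: (@log2_ge R 0).
Qed.

Lemma up_log_le_log2 (R : realType) (m : nat) :
  (up_log 2 m)%:R <= log2 (m%:R : R) + 1.
Proof.
case: (leqP m 1) => h.
  have -> : up_log 2 m = 0%N by apply/eqP; rewrite up_log_eq0 h orbT.
  by rewrite addr_ge0 ?log2_ge0.
have := @log2_ge R _ _ (ltnW (up_log_gtn (isT : (1 < 2)%N) h)).
have : (0 < up_log 2 m)%N by rewrite up_log_gt0 h.
by case: (up_log 2 m) => // k _ /= hk; rewrite -natr1 lerD2r.
Qed.

Theorem theorem6p2 (R : realType) (U : TM) (hU : universal U) :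
  exists c : R, forall (n1 n2 : nat) (Pi : protocol n1 n2)
      (x : cube n1) (y : cube n2),
    let t := transcript Pi x y in
    let P := enc_protocol Pi in
    let n := max_length Pi x y in
    `| (IC U Pi x y)%:~R - ((KC U t P)%:R - (I3 U x y t P)%:~R) |
        <= c * log2 (n%:R + 2)
    /\
    (IC U Pi x y)%:~R <= (KC U t P)%:R
        + log2 (thickness Pi (chosen Pi (x, y)))%:R + c * log2 (n%:R + 2).
Proof.
have [c hc] := information_cost_bounds hU.
(* The extra 1 pays for rounding the logarithm of the thickness up to an integer exponent, since the
   logarithm of [n + 2] is at least 1. *)
exists (c%:R + 1) => n1 n2 Pi x y t P n.
have [h1 h2] := hc n1 n2 Pi x y; rewrite -/t -/P -/n in h1 h2.
have hlog : (loglen n)%:R <= log2 (n%:R + 2) :> R.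
  by rewrite -natrD addn2; apply: log2_ge; exact: trunc_logP.
have hlog1 : 1 <= log2 (n%:R + 2) :> R.
  by apply: le_trans hlog; rewrite ler1n loglen_gt0.
have he : (c * loglen n)%:R <= c%:R * log2 (n%:R + 2) :> R.
  by rewrite natrM ler_wpM2l.
split.
  apply: (@le_trans _ _ (c * loglen n)%:R).
    have -> : (KC U t P)%:R = ((KC U t P)%:Z)%:~R :> R by [].
    by rewrite -!rmorphB /= -intr_norm -[(c * loglen n)%:R]/((c * loglen n)%:Z)%:~R ler_int.
  by apply: le_trans he _; rewrite mulrDl mul1r lerDl; apply: le_trans hlog1.
have := h2 (up_log 2 (thickness Pi (chosen Pi (x, y)))) (up_logP _ (isT : (1 < 2)%N)).
rewrite -(ler_int R) !rmorphD /= => /le_trans; apply.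
rewrite -!addrA lerD2l mulrDl mul1r.
have := @up_log_le_log2 R (thickness Pi (chosen Pi (x, y))).
lra.
Qed.
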